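(* Let $F\in L^2(E_A)$ be such that $\mathbb{E}[F\mid Z]=0$. Then $$\operatorname{var}[F\mid Z]\le\mathbb{E}[\Gamma(F,F)\mid Z]\quad\text{almost surely}.$$
   Context: Setting. $A$ is an at most countable set, $E_0$ and $(E_a)_{a\in A}$ are Polish spaces and $E_A=\prod_{a\in A}E_a$. On a probability space, $Z$ is an $E_0$-valued random variable and $X=(X_a)_{a\in A}$ is a family of random variables, $X_a$ being $E_a$-valued, which is conditionally independent given $Z$: for each $a$, the conditional law of $X_a$ given $\sigma((X_b)_{b\ne a},Z)$ equals its conditional law given $\sigma(Z)$. $L^2(E_A)$ is the space of real square-integrable functionals $F=F(X)$ of $X$. The carré du champ operator is $$\Gamma(F,G)=\frac12\sum_{a\in A}\mathbb{E}\big[(F-F^{\{a\}'})(G-G^{\{a\}'})\,\big|\,X,Z\big],$$ where $F^{\{a\}'}=F(X^{\{a\}},X'_a)$ is obtained by replacing the coordinate $X_a$ by $X'_a$, and $X'_a$ has the conditional law of $X_a$ given $Z$ and is conditionally independent of $X$ given $Z$. In particular $\Gamma(F,F)\in[0,\infty]$ is defined for every $F\in L^2(E_A)$. (On cylindrical functionals, i.e. those depending on finitely many coordinates, $\Gamma(F,G)=\frac12\{\mathsf{L}(FG)-F\mathsf{L}G-G\mathsf{L}F\}$ with $\mathsf{L}F=-\sum_{a\in A}(F-\mathbb{E}[F\mid (X_b)_{b\neq a},Z])$.) *)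

(* Defs.v *)
From HB Require Import structures.
From mathcomp Require Import all_boot all_order all_algebra.
From mathcomp Require Import all_classical all_reals all_analysis.
From mathcomp Require Import measurable_realfun.
Import Order.TTheory GRing.Theory Num.Theory.
Import numFieldNormedType.Exports.

Set Implicit Arguments.
Unset Strict Implicit.
Unset Printing Implicit Defensive.

Local Open Scope classical_set_scope.
Local Open Scope ring_scope.

Record complete_metric_of (R : realType) (T : topologicalType)
    (dist : T -> T -> R) : Prop := CompleteMetricOf {
  cmetric_xx : forall x, dist x x = 0 ;
  cmetric_eq : forall x y, dist x y = 0 -> x = y ;
  cmetric_sym : forall x y, dist x y = dist y x ;
  cmetric_triangle : forall x y z, dist x z <= dist x y + dist y z ;
  cmetric_nbhs : forall (x : T) (U : set T),
    nbhs x U <-> exists2 e, 0 < e & [set y | dist x y < e] `<=` U ;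
  cmetric_complete : forall u : nat -> T,
    (forall e, 0 < e ->
      exists N, forall m n, (N <= m)%N -> (N <= n)%N -> dist (u m) (u n) < e) ->
    exists l : T, u @ \oo --> l }.

Definition polish (R : realType) (T : topologicalType) : Prop :=
  (exists2 D : set T, countable D & dense D) /\
  (exists dist : T -> T -> R, complete_metric_of dist).

(* [g_sigma_algebraType] asks for a pointed type; as the spaces below are targets
   of random variables they are nonempty, so this is no restriction. *)
Notation borel T := (g_sigma_algebraType (@open T)).

(* the product sigma-algebra on \prod_a E a is generated by the coordinates *)
Definition coord_sets (A : Type) (E : A -> ptopologicalType) :
    set (set (forall a, borel (E a))) :=
  \bigcup_a preimage_set_system setT
    (fun x : forall a, borel (E a) => x a) measurable.

Notation prod_space E := (g_sigma_algebraType (@coord_sets _ E)).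

Section conditional_expectation.
Context d (T : measurableType d) (R : realType) (P : probability T R).
Local Open Scope ereal_scope.
Implicit Types (G : set (set T)) (Y W : T -> \bar R).

(* Conditioning is always on the sigma-algebra <<s G >> generated by G. *)
Definition is_condexp G Y W : Prop :=
  (forall B : set (\bar R), measurable B -> <<s G >> (W @^-1` B)) /\
  (forall S, <<s G >> S -> \int[P]_(w in S) W w = \int[P]_(w in S) Y w).

(* A version of E[Y | <<s G >>]; one exists when Y is integrable or measurable
   and nonnegative, see [condexpP_ge0] and [condexpP] below. *)
Definition condexp G Y : T -> \bar R := xget (cst 0) [set W | is_condexp G Y W].

Definition condvar G Y : T -> \bar R :=
  condexp G (fun w => (Y w - condexp G Y w) ^+ 2).

End conditional_expectation.

Section condexp_existence_aux.
Context d (T : measurableType d) (R : realType) (Q : probability T R).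
Local Open Scope ereal_scope.
Variables (n : set T -> \bar R) (n0 : n set0 = 0) (n_ge0 : forall S, 0 <= n S)
  (n_sa : semi_sigma_additive n) (n_fin : fin_num_fun n).

(* a constant carrying the measure structure of n *)
Definition finite_measure_of (_ : n set0 = 0) (_ : forall S, 0 <= n S)
  (_ : semi_sigma_additive n) (_ : fin_num_fun n) : set T -> \bar R := n.

Local Notation nu := (finite_measure_of n0 n_ge0 n_sa n_fin).

HB.instance Definition _ := isMeasure.Build _ _ _ nu n0 n_ge0 n_sa.
HB.instance Definition _ := Measure_isFinite.Build _ _ _ nu n_fin.

Lemma rn_ge0 : (forall S, measurable S -> Q S = 0 -> n S = 0) ->
  exists f : T -> \bar R, [/\ forall x, 0 <= f x,
    Q.-integrable setT f &
    forall S, measurable S -> n S = \int[Q]_(x in S) f x].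
Proof.
move=> nQ; have nuQ : nu `<< Q by exact/null_content_dominatesP.
by have [f [? ? ? ?]] := radon_nikodym_sigma_finite nuQ; exists f.
Qed.

End condexp_existence_aux.

Section condexp_existence.
Context d (T : measurableType d) (R : realType) (P : probability T R).
Local Open Scope ereal_scope.
Variables (G : set (set T)) (G_measurable : G `<=` measurable).

Let sG S : <<s G >> S -> measurable S.
Proof.
by move=> ?; apply: (smallest_sub (@sigma_algebra_measurable _ T) G_measurable).
Qed.

Let T_nonempty : [set: T] !=set0.
Proof.
apply/set0P/eqP => T0; have := probability_setT P.
by rewrite T0 measure0 => /eqP; rewrite eqe eq_sym oner_eq0.
Qed.

Lemma condexp_ex_int (Y : T -> \bar R) :
  P.-integrable setT Y -> (forall w, 0 <= Y w) ->
  exists W : T -> \bar R, [/\ forall w, 0 <= W w,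
    (forall B : set (\bar R), measurable B -> <<s G >> (W @^-1` B)),
    P.-integrable setT W &
    forall S, <<s G >> S -> \int[P]_(w in S) W w = \int[P]_(w in S) Y w].
Proof.
move=> iY Y0; have mY := measurable_int _ iY.
have [w0 _] := T_nonempty.
pose pT : pointedType :=
  HB.pack (T : Type) (gen_eqMixin T) (gen_choiceMixin T) (isPointed.Build T w0).
pose T' : measurableType _ := g_sigma_algebraType (G : set (set pT)).
pose id' : T -> T' := idfun.
have mid : measurable_fun setT id' by move=> _ S mS; rewrite setTI; exact: sG.
pose id'' : {mfun T >-> T'} := HB.pack id' (isMeasurableFun.Build _ _ _ _ _ mid).
pose Q : probability T' R := distribution P id''.
pose n0 := fun S : set T' => \int[P]_(w in (S : set T)) Y w.
have n00 : n0 set0 = 0 by rewrite /n0 integral_set0.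
have n0ge S : 0 <= n0 S by apply: integral_ge0.
have n0sa : semi_sigma_additive n0.
  move=> F mF tF mUF; apply: semi_sigma_additive_nng_induced => //.
    by move=> i; apply: sG; exact: mF.
  exact: sG.
have n0fin : fin_num_fun n0.
  move=> S mS; apply: integrable_fin_num; first exact: sG.
  by apply: integrableS iY => //; exact: sG.
have [|W [W0 iW WE]] := @rn_ge0 _ T' R Q n0 n00 n0ge n0sa n0fin.
  move=> S mS QS.
  apply: null_set_integral => //; [exact: sG| exact: measurable_funTS].
have mW := measurable_int _ iW.
have QP S : <<s G >> S -> \int[Q]_(w in S) W w = \int[P]_(w in S) W w.
  move=> mS; rewrite /Q /distribution ge0_integral_pushforward//.
  exact: measurable_funTS.
exists W; split => //.
- by move=> B mB; have := mW measurableT B mB; rewrite setTI.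
- apply/integrableP; split.
    by move=> _ B mB; rewrite setTI; apply: sG; have := mW measurableT B mB; rewrite setTI.
  have /integrableP[_] := iW; congr (_ < _).
  under eq_integral do rewrite gee0_abs//.
  under [RHS]eq_integral do rewrite gee0_abs//.
  by rewrite QP//; exact: (@measurableT _ T').
- by move=> S mS; rewrite -QP// -WE.
Qed.

Lemma is_condexp_ge0 (Y : T -> \bar R) :
  measurable_fun setT Y -> (forall w, 0 <= Y w) -> exists W, is_condexp P G Y W.
Proof.
move=> mY Y0.
pose mn k w : \bar R := mine (Y w) k%:R%:E.
pose y k w : \bar R := mn k.+1 w - mn k w.
have mnf k w : mn k w \is a fin_num.
  rewrite ge0_fin_numE; first by rewrite gt_min ltry orbT.
  by rewrite le_min Y0 lee_fin ler0n.
have mle k w : mn k w <= mn k.+1 w.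
  by rewrite /mn le_min !ge_min lexx/= lee_fin ler_nat leqnSn orbT.
have mmn k : measurable_fun setT (mn k) by exact: measurable_mine.
have y0 k w : 0 <= y k w by rewrite sube_ge0 ?mle// mnf.
have my k : measurable_fun setT (y k) by exact: emeasurable_funB.
have iy k : P.-integrable setT (y k).
  apply: (@le_integrable _ _ _ P setT _ _ (cst k.+1%:R%:E)) => //; first last.
    exact: (@finite_measure_integrable_cst _ _ _ P _).
  move=> w _; rewrite gee0_abs// gee0_abs ?lee_fin//.
  apply: (@le_trans _ _ (mn k.+1 w)); last by rewrite /mn ge_min lexx orbT.
  by rewrite leeBlDr// leeDl// le_min Y0 lee_fin ler0n.
have sumy n w : \sum_(0 <= k < n) y k w = mn n w.
  elim: n => [|n IH]; first by rewrite big_geq// /mn /= min_r.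
  by rewrite big_nat_recr//= IH addeC /y (subeK _ (mnf n w)).
have seriesy w : \sum_(k <oo) y k w = Y w.
  under eq_fun do rewrite sumy.
  apply/cvg_lim => //.
  have := Y0 w; rewrite /mn; case: (Y w) => // [r r0|_].
    apply: cvg_near_cst; exists (Num.bound r) => // n /= rn.
    apply/eqP; rewrite /= minEle lee_fin ifT//.
    rewrite (le_trans (ltW (archi_boundP _)))// ?ler_nat//.
  rewrite (_ : (fun n => _) = (fun n => n%:R%:E)); last first.
    by apply/funext => n; rewrite min_r ?leey.
  apply/cvgeryP; exact: cvgr_idn.
have := fun k => condexp_ex_int (iy k) (y0 k).
move=> /choice[W HW].
have [w0 _] := T_nonempty.
pose pT : pointedType :=
  HB.pack (T : Type) (gen_eqMixin T) (gen_choiceMixin T) (isPointed.Build T w0).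
exists (fun w => \sum_(k <oo) W k w); split.
  move=> B mB; rewrite -[X in <<s G >> X]setTI.
  pose T' : measurableType _ := g_sigma_algebraType (G : set (set pT)).
  apply: (@ge0_emeasurable_sum _ T' R setT W xpredT) => //.
  - by move=> k w _ _; have [] := HW k.
  - by move=> k _ _ C mC; rewrite setTI; have [_ + _ _] := HW k; exact.
move=> S mS.
have mW k : measurable_fun S (W k).
  have [_ _ /measurable_int + _] := HW k; exact: measurable_funTS.
rewrite integral_nneseries//; [|exact: sG|by move=> k w _; have [] := HW k].
under [RHS]eq_integral do rewrite -seriesy.
rewrite integral_nneseries//; [|exact: sG|by move=> k; exact: measurable_funTS].
by apply: eq_eseriesr => k _; have [_ _ _ ->] := HW k.
Qed.

Lemma is_condexp_int (Y : T -> \bar R) :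
  P.-integrable setT Y -> exists W, is_condexp P G Y W.
Proof.
move=> iY.
have [Wp [Wp0 mWp iWp WpE]] := condexp_ex_int (integrable_funepos measurableT iY) (funepos_ge0 _).
have [Wn [Wn0 mWn iWn WnE]] := condexp_ex_int (integrable_funeneg measurableT iY) (funeneg_ge0 _).
have [w0 _] := T_nonempty.
pose pT : pointedType :=
  HB.pack (T : Type) (gen_eqMixin T) (gen_choiceMixin T) (isPointed.Build T w0).
exists (Wp \- Wn); split.
  move=> B mB; rewrite -[X in <<s G >> X]setTI.
  pose T' : measurableType _ := g_sigma_algebraType (G : set (set pT)).
  apply: (@emeasurable_funB _ T' R setT Wp Wn) => //.
  - by move=> _ C mC; rewrite setTI; exact: mWp.
  - by move=> _ C mC; rewrite setTI; exact: mWn.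
move=> S mS; have mS' := sG mS.
rewrite integralB//; [|exact: integrableS iWp|exact: integrableS iWn].
by rewrite WpE// WnE// [RHS]integralE.
Qed.

Lemma condexpP_ge0 (Y : T -> \bar R) : measurable_fun setT Y ->
  (forall w, 0 <= Y w) -> is_condexp P G Y (condexp P G Y).
Proof.
by move=> mY Y0; have [W /(@xgetI (T -> \bar R) (cst 0) _ W)] := is_condexp_ge0 mY Y0.
Qed.

Lemma condexpP (Y : T -> \bar R) :
  P.-integrable setT Y -> is_condexp P G Y (condexp P G Y).
Proof.
by move=> iY; have [W /(@xgetI (T -> \bar R) (cst 0) _ W)] := is_condexp_int iY.
Qed.

End condexp_existence.

Section carre_du_champ.
Context d (T : measurableType d) (R : realType) (P : probability T R).
Local Open Scope ereal_scope.

Definition sigma_of d' (S : measurableType d') (Y : T -> S) : set (set T) :=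
  preimage_set_system setT Y measurable.

Definition condlaw d' (S : measurableType d') (G : set (set T)) (Y : T -> S)
    (w : T) (B : set S) : \bar R :=
  condexp P G (fun w' => (\1_(Y @^-1` B) w')%:E) w.

(* Almost sure equality of conditional laws, tested on each measurable set; for
   the countably generated Borel sigma-algebra of a Polish space this is the
   a.s. equality of the regular conditional distributions. *)
Definition same_condlaw d' (S : measurableType d') (Y : T -> S)
    (G1 G2 : set (set T)) : Prop :=
  forall B, measurable B ->
    {ae P, forall w, condlaw G1 Y w B = condlaw G2 Y w B}.

Section family.
Context (A : countType) (E0 : ptopologicalType) (E : A -> ptopologicalType).
Variables (Z : {RV P >-> borel E0}) (X X' : forall a, {RV P >-> borel (E a)}).

Definition sigma_fam (D : set A) : set (set T) := \bigcup_(a in D) sigma_of (X a).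

(* (X_a)_a is conditionally independent given Z. *)
Definition cond_independent : Prop := forall a,
  same_condlaw (X a) (sigma_fam [set b | b != a] `|` sigma_of Z) (sigma_of Z).

(* X'_a has the conditional law of X_a given Z and is conditionally independent
   of X given Z. *)
Definition cond_independent_copy : Prop := forall a,
  (forall B, measurable B -> {ae P, forall w,
    condlaw (sigma_of Z) (X' a) w B = condlaw (sigma_of Z) (X a) w B}) /\
  same_condlaw (X' a) (sigma_fam setT `|` sigma_of Z) (sigma_of Z).

Definition joint (w : T) : prod_space E := fun a => X a w.

Definition resample (a : A) (w : T) : prod_space E :=
  @dfwith A (fun b => borel (E b)) (joint w) a (X' a w).

(* Sums over A of possibly signed terms are the difference of the sums of the
   positive and of the negative parts, [esum] being meant for nonnegative terms.
   For F = H the terms are a.s. nonnegative. *)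
Definition carre_du_champ (F H : prod_space E -> R) (w : T) : \bar R :=
  let D a := condexp P (sigma_fam setT `|` sigma_of Z)
    (fun w' => ((F (joint w') - F (resample a w'))
                * (H (joint w') - H (resample a w')))%:E) in
  (2^-1)%R%:E * (\esum_(a in [set: A]) maxe (D a w) 0
             - \esum_(a in [set: A]) maxe (- D a w) 0).

End family.
End carre_du_champ.

(* Main.v *)
Require Import Defs.
From HB Require Import structures.
From mathcomp Require Import all_boot all_order all_algebra.
From mathcomp Require Import all_classical all_reals all_analysis.
From mathcomp Require Import measurable_realfun.
From mathcomp Require Import finmap ring lra.
Import Order.TTheory GRing.Theory Num.Theory.
Import numFieldNormedType.Exports.
Local Open Scope classical_set_scope.
Local Open Scope ring_scope.

(** The statement is a conditional Efron-Stein (Poincare) inequality for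
    countably many coordinates. Conditioning on [Z] is removed by testing both
    sides on the sets S of the sigma-algebra of [Z] ([ae_le_of_integrals]): with
    f the product of the indicator of S and of F(X), and f_a the same with the
    coordinate a resampled, it suffices that

      E[f^2] <= 1/2 \sum_a E[(f - f_a)^2].

    The proof is by duality with simple test functions, so that neither
    conditional expectations of general functions nor martingale convergence
    enter. Let h be a finite sum of terms g(Z) 1(X_a \in B_a for all a), where
    B_a is the whole space except for a in a finite set s. Averaging the
    coordinate a out of h replaces the factor 1(X_a \in B_a) by the conditional
    probability of X_a \in B_a given Z and yields a function k of the same kind
    that does not depend on the coordinate a, with E[u h_a] = E[u k] for every
    square-integrable function u of X and Z ([averaging]). The only other
    ingredient is that X and the resampled family can be exchanged jointly
    ([exchange]), which follows from conditional independence on rectangles and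
    a pi-system argument. Together they give

      E[(f - f_a) (h - h_a)] = 2 E[f h] - 2 E[f k],
      E[(h - h_a)^2] = 2 E[h^2] - 2 E[k^2],

    so that (f - f_a) (h - h_a) <= ((f - f_a)^2 + (h - h_a)^2) / 2 reads

      2 E[f h] - E[h^2] <= 1/2 E[(f - f_a)^2] + (2 E[f k] - E[k^2]).

    After all coordinates of s are averaged out, the last parenthesis involves a
    function k of Z alone; there E[f k] = 0 because E[F | Z] = 0. Hence
    2 E[f h] - E[h^2] <= 1/2 \sum_(a in s) E[(f - f_a)^2]
    ([efron_stein_cylindrical]). The left-hand side is E[f^2] - E[(f - h)^2], and
    the functions h are dense in L2 ([L2_approximation]). *)

Set Implicit Arguments.
Unset Strict Implicit.
Unset Printing Implicit Defensive.

(** * Conditioning on a sub-sigma-algebra *)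

Section sub_sigma_algebra.
Context d (T : measurableType d) (R : realType) (P : probability T R).
Variables (G : set (set T)) (Gm : G `<=` measurable).
Local Notation TG := (g_sigma_algebraType G).

Lemma sub_measurable (S : set T) : <<s G >> S -> measurable S.
Proof. exact: (smallest_sub (@sigma_algebra_measurable _ T) Gm). Qed.

Lemma sub_measurable_fun d' (S : measurableType d') (f : T -> S) :
  measurable_fun setT (f : TG -> S) -> measurable_fun setT f.
Proof.
move=> mf _ B mB; rewrite setTI; apply: sub_measurable.
by have := mf measurableT B mB; rewrite setTI.
Qed.

Lemma condexp_measurable Y (W : T -> \bar R) :
  is_condexp P G Y W -> measurable_fun setT (W : TG -> \bar R).
Proof. by move=> [mW _] _ B mB; rewrite setTI; exact: mW. Qed.

Local Open Scope ereal_scope.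

(** On the set where V < U the integral of U - V > 0 is nonpositive, so that set
    is null. There V is integrable: its positive part is below that of U, and an
    infinite negative part would contradict the hypothesis. *)
Lemma ae_le_of_integrals (U V : T -> \bar R) :
  measurable_fun setT (U : TG -> \bar R) -> measurable_fun setT (V : TG -> \bar R) ->
  P.-integrable setT U ->
  (forall S, <<s G >> S -> \int[P]_(w in S) U w <= \int[P]_(w in S) V w) ->
  {ae P, forall w, U w <= V w}.
Proof.
move=> mU mV iU UV.
pose S := [set w | V w < U w].
have GS : <<s G >> S.
  by have := @measurable_lte _ TG _ setT measurableT _ _ mV mU; rewrite setTI.
have mS := sub_measurable GS.
have mVS := measurable_funS (D := S) measurableT (@subsetT _ _) (sub_measurable_fun mV).
have iUS : P.-integrable S U by exact: integrableS iU.
have UVS := UV _ GS.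
have fU := integrable_fin_num mS iUS.
have fVp : \int[P]_(w in S) V^\+ w < +oo.
  apply: (@le_lt_trans _ _ (\int[P]_(w in S) U^\+ w)).
    apply: ge0_le_integral => //.
    - exact: measurable_funepos.
    - by apply: measurable_funepos; exact: measurable_int iUS.
    - move=> w; rewrite /S/= => /ltW VU; rewrite !funeposE.
      by rewrite ge_max !le_max VU lexx orbT.
  by have /integrableP[_] := integrable_funepos mS iUS; under eq_integral do
    rewrite gee0_abs//.
have fVn : \int[P]_(w in S) V^\- w < +oo.
  rewrite ltey; apply/eqP => Vn; move: UVS; rewrite [leRHS]integralE Vn addeNy.
  by rewrite leeNy_eq => /eqP UN; move: fU; rewrite UN.
have iVS : P.-integrable S V.
  apply/integrableP; split => //.
  rewrite -/(abse \o V) fune_abse.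
  rewrite ge0_integralD//;
    [exact: lte_add_pinfty|exact: measurable_funepos|exact: measurable_funeneg].
have UV0 w : S w -> 0 < U w - V w by rewrite sube_gt0.
have mUV : measurable_fun S (U \- V).
  by apply: emeasurable_funB => //; exact: measurable_int iUS.
have : \int[P]_(w in S) `|(U \- V) w| = 0.
  apply/eqP; rewrite eq_le; apply/andP; split; last exact: integral_ge0.
  under eq_integral => w /set_mem Sw do rewrite gee0_abs/= ?(ltW (UV0 _ Sw))//.
  by rewrite integralB// sube_le0// integrable_fin_num.
move=> /(ae_eq_integral_abs _ mS mUV).
apply: filterS => w UVw; rewrite leNgt; apply/negP => /[dup] /UVw + /UV0.
by move=> /= ->; rewrite ltxx.
Qed.

Import HBNNSimple.

(** Approximating [v] from below by simple functions reduces the claim to the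
    sets of <<s G >>; domination is provided by [v * f] itself. *)
Let integral_pullout_ge0 (f v : T -> R) :
  P.-integrable setT (EFin \o f) ->
  (forall S, <<s G >> S -> \int[P]_(w in S) (f w)%:E = 0) ->
  measurable_fun setT (v : TG -> R) -> (forall w, 0 <= v w)%R ->
  P.-integrable setT (EFin \o (v \* f)%R) ->
  \int[P]_w (v w * f w)%:E = 0.
Proof.
move=> fi f0 mv v0 ivf.
have mev : measurable_fun setT (EFin \o v : TG -> \bar R) by exact/measurable_EFinP.
have mf : measurable_fun setT f by apply/measurable_EFinP; exact: measurable_int fi.
pose h n := nnsfun_approx (@measurableT _ TG) mev n.
have hv w : h n w @[n --> \oo] --> v w.
  have /fine_cvg := @cvg_nnsfun_approx _ TG _ _ measurableT _ mev (fun w _ => v0 w) w I.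
  exact.
have hle n w : (h n w <= v w)%R.
  rewrite -lee_fin /h nnsfun_approxE.
  by apply: le_approx => //= w' _; rewrite lee_fin.
have mh n : measurable_fun setT (h n : T -> R) by exact: sub_measurable_fun.
have h0 n : \int[P]_w (h n w * f w)%:E = 0.
  have mS (r : R) : <<s G >> (h n @^-1` [set r]).
    have mhn : measurable_fun setT (h n : TG -> R) by [].
    by have := mhn measurableT [set r] (measurable_set1 r); rewrite setTI.
  have hE w : (h n w * f w)%:E = \sum_(r <- fset_set (range (h n)))
      r%:E * ((EFin \o f) \_ (h n @^-1` [set r])) w.
    rewrite fimfunE/= (fsbig_finite _ _ (fimfunP _))//= mulr_suml -sumEFin.
    by apply: eq_bigr => r _; rewrite epatch_indic/= -!EFinM; congr EFin; ring.
  have ih (r : R) : P.-integrable setT ((EFin \o f) \_ (h n @^-1` [set r])).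
    have mSr := sub_measurable (mS r).
    by apply/(integrable_mkcond _ mSr); exact: integrableS fi.
  under eq_integral do rewrite hE.
  rewrite integral_sum//; last by move=> r; exact: integrableZl.
  apply: big1 => r _; rewrite integralZl// -integral_mkcond.
  by rewrite f0// mule0.
have : \int[P]_w (h n w * f w)%:E @[n --> \oo] --> \int[P]_w (v w * f w)%:E.
  have [] // := @dominated_convergence _ T R P setT measurableT
    (fun n w => (h n w * f w)%:E) (fun w => (v w * f w)%:E) (fun w => `|(v w * f w)%:E|).
  - by move=> n; apply/measurable_EFinP; apply: measurable_funM.
  - exact: measurable_int ivf.
  - apply: aeW => w _; apply/cvg_EFin; first exact: nearW.
    exact: cvgMl.
  - exact: integrable_abse.
  - apply: aeW => w n _ /=; rewrite lee_fin !normrM ler_wpM2r//.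
    by rewrite !ger0_norm// hle.
under eq_fun do rewrite h0.
by move=> /cvg_unique; apply => //; exact: cvg_cst.
Qed.

(** The form in which known factors are taken out of a conditional expectation:
    if f has zero conditional expectation, so does v * f. *)
Lemma integral_pullout (f v : T -> R) :
  P.-integrable setT (EFin \o f) ->
  (forall S, <<s G >> S -> \int[P]_(w in S) (f w)%:E = 0) ->
  measurable_fun setT (v : TG -> R) ->
  P.-integrable setT (EFin \o (v \* f)%R) ->
  \int[P]_w (v w * f w)%:E = 0.
Proof.
move=> fi f0 mv ivf.
have mf : measurable_fun setT f by apply/measurable_EFinP; exact: measurable_int fi.
pose vp w := Num.max (v w) 0%R; pose vn w := Num.max (- v w)%R 0%R.
have mvp : measurable_fun setT (vp : TG -> R) by exact: measurable_maxr.
have mvn : measurable_fun setT (vn : TG -> R).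
  by apply: measurable_maxr => //; exact: measurableT_comp.
have dom (u : T -> R) : measurable_fun setT (u : TG -> R) ->
    (forall w, `|u w| <= `|v w|)%R -> P.-integrable setT (EFin \o (u \* f)%R).
  move=> mu uv; apply: le_integrable ivf => //.
    by apply/measurable_EFinP; apply: measurable_funM => //; exact: sub_measurable_fun.
  by move=> w _ /=; rewrite lee_fin !normrM ler_wpM2r.
have ivp : P.-integrable setT (EFin \o (vp \* f)%R).
  by apply: dom => // w; rewrite /vp maxEle; case: ifP; rewrite ?normr0.
have ivn : P.-integrable setT (EFin \o (vn \* f)%R).
  by apply: dom => // w; rewrite /vn maxEle; case: ifP; rewrite ?normr0 ?normrN.
have vE w : v w = (vp w - vn w)%R.
  rewrite /vp /vn; case: (ltP (v w) 0%R) => v0.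
    by rewrite max_l ?oppr_ge0 ?ltW// sub0r opprK.
  by rewrite max_r ?oppr_le0// subr0.
under eq_integral do rewrite vE mulrBl EFinB.
rewrite integralB//.
rewrite (integral_pullout_ge0 fi f0 mvp _ ivp); last by move=> w; rewrite le_max lexx orbT.
rewrite (integral_pullout_ge0 fi f0 mvn _ ivn); last by move=> w; rewrite le_max lexx orbT.
by rewrite sube0.
Qed.

End sub_sigma_algebra.

Section conditional_expectation_facts.
Context d (T : measurableType d) (R : realType) (P : probability T R).
Variables (G : set (set T)) (Gm : G `<=` measurable).
Local Open Scope ereal_scope.
Implicit Types Y : T -> \bar R.

(** A genuine equality, not an almost sure one: [condexp] chooses a version
    among those characterised by the integrals of Y. *)
Lemma condexp_ae_eq Y Y' : measurable_fun setT Y -> measurable_fun setT Y' ->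
  {ae P, forall w, Y w = Y' w} -> condexp P G Y = condexp P G Y'.
Proof.
move=> mY mY' YY'; congr xget; apply/funext => W; apply/propext.
have E S : <<s G >> S -> \int[P]_(w in S) Y w = \int[P]_(w in S) Y' w.
  move=> GS; have mS := sub_measurable Gm GS.
  apply: ae_eq_integral => //; [exact: measurable_funTS|exact: measurable_funTS|].
  by apply: filterS YY' => w + _.
by split=> -[mW WE]; split => // S GS; rewrite WE// E.
Qed.

Lemma condexp_ae_ge0 Y : measurable_fun setT Y -> (forall w, 0 <= Y w) ->
  {ae P, forall w, 0 <= condexp P G Y w}.
Proof.
move=> mY Y0; have cY := condexpP_ge0 P Gm mY Y0.
apply: (ae_le_of_integrals Gm (U := cst 0)) => //.
- exact: condexp_measurable cY.
- exact: integrable0.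
- by move=> S GS; rewrite integral0 cY.2//; exact: integral_ge0.
Qed.

Lemma condexp_integrable Y : (forall w, 0 <= Y w) -> P.-integrable setT Y ->
  P.-integrable setT (condexp P G Y).
Proof.
move=> Y0 iY; have mY := measurable_int _ iY.
have cY := condexpP_ge0 P Gm mY Y0.
have mW := sub_measurable_fun Gm (condexp_measurable cY).
apply/integrableP; split => //.
rewrite (@ae_eq_integral _ _ _ P setT (condexp P G Y))//.
- rewrite cY.2; last exact: (@measurableT _ (g_sigma_algebraType G)).
  by rewrite ltey_eq integrable_fin_num.
- exact: measurableT_comp.
- by apply: filterS (condexp_ae_ge0 mY Y0) => w q0 _; rewrite gee0_abs.
Qed.

End conditional_expectation_facts.

(** * Sums over countable types *)

Section sums_over_countable_types.
Context d (T : measurableType d) (R : realType) (A : countType).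
Local Open Scope ereal_scope.

Lemma measurable_esum (f : A -> T -> \bar R) :
  (forall a, measurable_fun setT (f a)) -> (forall a w, 0 <= f a w) ->
  measurable_fun setT (fun w => \esum_(a in [set: A]) f a w).
Proof.
move=> mf f0.
(* The enumeration of A by [pickle_inv] needs a default element. *)
have [[a0 _]|nA] := pselect (exists a : A, True); last first.
  rewrite (_ : (fun w => _) = cst 0); first exact: measurable_cst.
  by apply/funext => w; rewrite esum1// => a; exfalso; apply: nA; exists a.
pose e n := odflt a0 (pickle_inv n); pose Q : pred nat := fun n => pickle_inv n : option A.
have QE : e @` Q = setT.
  by apply/seteqP; split => // a _; exists (choice.pickle a); rewrite /Q /e pickleK_inv.
have einj : set_inj Q e.
  move=> m n /set_mem + /set_mem; rewrite /Q /e.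
  have := @pickle_invK A m; have := @pickle_invK A n.
  by case: (pickle_inv m) (pickle_inv n) => [a|] [b|] //= <- <- _ _ ->.
rewrite (_ : (fun w => _) = fun w => \sum_(n <oo | n \in Q) f (e n) w).
  exact: ge0_emeasurable_sum.
by apply/funext => w; rewrite -QE esum_pred_image.
Qed.

Lemma esum_ge_uniq (a : A -> \bar R) (s : seq A) : uniq s ->
  \sum_(i <- s) a i <= \esum_(i in [set: A]) a i.
Proof.
move=> us; apply: esum_ge; exists [set` s]; last by rewrite fsbig_seq.
by split => //; exact: finite_seq.
Qed.

Lemma ae_forall_countable (P : probability T R) (Q : A -> T -> Prop) :
  (forall a, {ae P, forall w, Q a w}) -> {ae P, forall w, forall a, Q a w}.
Proof.
move=> aQ; have : {ae P, forall w, forall n : nat,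
    if pickle_inv n is Some a then Q a w else True}.
  by apply: ae_foralln => n; case: (pickle_inv n) => [a|]; [exact: aQ|exact: aeW].
by apply: filterS => w Qw a; have := Qw (choice.pickle a); rewrite pickleK_inv.
Qed.

End sums_over_countable_types.

(** * Square-integrable functions *)

Section square_integrable.
Context d (T : measurableType d) (R : realType) (P : probability T R).
Implicit Types u v w : T -> R.

Definition square_integrable u := measurable_fun setT u /\
  P.-integrable setT (EFin \o (fun t => u t ^+ 2)).

Definition inner u v : R := \int[P]_t (u t * v t).

Lemma integrable_mul_square u v : square_integrable u -> square_integrable v ->
  P.-integrable setT (EFin \o (u \* v)).
Proof.
move=> [mu iu] [mv iv].
have iuv := integrableD measurableT iu iv.
apply: le_integrable iuv => //.
  by apply/measurable_EFinP; exact: measurable_funM.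
move=> t _; rewrite lee_fin /= [leRHS]ger0_norm ?addr_ge0 ?sqr_ge0//.
rewrite ler_norml; apply/andP; split.
  by have := sqr_ge0 (u t + v t); have := sqr_ge0 (u t); have := sqr_ge0 (v t); nra.
by have := sqr_ge0 (u t - v t); have := sqr_ge0 (u t); have := sqr_ge0 (v t); nra.
Qed.

Lemma square_integrable_bounded u (K : R) : measurable_fun setT u ->
  (forall t, `|u t| <= K) -> square_integrable u.
Proof.
move=> mu uK; split => //.
apply: (@le_integrable _ _ _ P setT _ _ (cst (K ^+ 2)%:E)) => //.
- by apply/measurable_EFinP; exact: measurable_funX.
- move=> t _ /=; rewrite lee_fin !normrX lerXn2r ?nnegrE//.
  by rewrite (le_trans (uK t))// ler_norm.
- exact: (@finite_measure_integrable_cst _ _ _ P _).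
Qed.

Lemma square_integrableM u v (K : R) : square_integrable u -> measurable_fun setT v ->
  (forall t, `|v t| <= K) -> square_integrable (u \* v).
Proof.
move=> [mu iu] mv vK; split; first exact: measurable_funM.
apply: (le_integrable measurableT _ _ (integrableZl measurableT (K ^+ 2) iu)).
  by apply/measurable_EFinP; apply: measurable_funX; exact: measurable_funM.
move=> t _; rewrite lee_fin /= ger0_norm ?sqr_ge0//.
rewrite [leRHS]ger0_norm ?(mulr_ge0 (sqr_ge0 _) (sqr_ge0 _))//.
rewrite exprMn mulrC.
rewrite ler_wpM2r ?sqr_ge0// -real_normK ?num_real//.
have K0 : 0 <= K by rewrite (le_trans _ (vK t)).
by rewrite lerXn2r.
Qed.

Lemma square_integrableB u v : square_integrable u -> square_integrable v ->
  square_integrable (u \- v).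
Proof.
move=> [mu iu] [mv iv]; split; first exact: measurable_funB.
have := integrableZl measurableT 2 (integrableD measurableT iu iv).
apply: le_integrable => //.
  by apply/measurable_EFinP; apply: measurable_funX; exact: measurable_funB.
move=> t _ /=; rewrite lee_fin ger0_norm ?sqr_ge0//.
apply: le_trans (ler_norm _).
by have := sqr_ge0 (u t + v t); nra.
Qed.

Lemma integrable_square u : square_integrable u -> P.-integrable setT (EFin \o u).
Proof.
have i1 : square_integrable (cst 1).
  by apply: (@square_integrable_bounded _ 1) => // t; rewrite normr1.
move=> /(integrable_mul_square i1); rewrite (_ : cst 1 \* u = u)//.
by apply/funext => t /=; rewrite mul1r.
Qed.

Lemma innerC u v : inner u v = inner v u.
Proof. by apply: eq_Rintegral => t _; rewrite mulrC. Qed.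

Lemma inner_ge0 u : 0 <= inner u u.
Proof. by apply: Rintegral_ge0 => t _; rewrite -expr2 sqr_ge0. Qed.

Lemma innerBl u v w : square_integrable u -> square_integrable v ->
  square_integrable w -> inner (u \- v) w = inner u w - inner v w.
Proof.
move=> iu iv iw; rewrite -RintegralB//; [|exact: integrable_mul_square..].
by apply: eq_Rintegral => t _ /=; rewrite mulrBl.
Qed.

Lemma innerBr u v w : square_integrable u -> square_integrable v ->
  square_integrable w -> inner w (u \- v) = inner w u - inner w v.
Proof. by move=> iu iv iw; rewrite innerC innerBl// !(innerC w). Qed.

Lemma innerBB u v : square_integrable u -> square_integrable v ->
  inner (u \- v) (u \- v) = inner u u - 2 * inner u v + inner v v.
Proof.
move=> iu iv; have iuv := square_integrableB iu iv.
by rewrite innerBl// !innerBr// (innerC v u); ring.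
Qed.

Lemma innerDl u v w : square_integrable u -> square_integrable v ->
  square_integrable w -> inner (u \+ v) w = inner u w + inner v w.
Proof.
move=> iu iv iw; rewrite -RintegralD//; [|exact: integrable_mul_square..].
by apply: eq_Rintegral => t _ /=; rewrite mulrDl.
Qed.

Lemma inner_EFin u : square_integrable u ->
  (inner u u)%:E = (\int[P]_t (u t ^+ 2)%:E)%E.
Proof.
move=> [mu iu]; rewrite fineK; first by apply: eq_integral => t _; rewrite -expr2.
under eq_fun do rewrite -expr2.
exact: integrable_fin_num iu.
Qed.

End square_integrable.

Section L2_density.
Context d (M : measurableType d) (R : realType) (mu : probability M R).
Variables (G : set (set M)) (V : (M -> R) -> Prop).
Hypotheses (GT : G setT) (GI : setI_closed G) (GE : measurable = <<s G >>).
Hypotheses (Vm : forall h, V h -> measurable_fun setT h)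
  (VD : forall h k, V h -> V k -> V (h \+ k)%R)
  (VZ : forall c h, V h -> V (fun x => c * h x)%R)
  (VG : forall C, G C -> V (\1_C)).
Local Open Scope ereal_scope.

Let dist2 (f h : M -> R) := \int[mu]_x ((f x - h x) ^+ 2)%:E.

Let approximable (f : M -> R) := measurable_fun setT f /\
  forall e : R, (0 < e)%R -> exists2 h, V h & dist2 f h <= e%:E.

Let mdist2 (f h : M -> R) : measurable_fun setT f -> measurable_fun setT h ->
  measurable_fun setT (fun x => ((f x - h x) ^+ 2)%:E).
Proof.
by move=> mf mh; apply/measurable_EFinP; apply: measurable_funX; exact: measurable_funB.
Qed.

Let sq0 (f h : M -> R) x : 0 <= ((f x - h x) ^+ 2)%:E.
Proof. by rewrite lee_fin sqr_ge0. Qed.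

Let dist2_add (f f' h h' : M -> R) : measurable_fun setT f -> measurable_fun setT f' ->
  measurable_fun setT h -> measurable_fun setT h' ->
  dist2 (f \+ f')%R (h \+ h')%R <= 2%:E * (dist2 f h + dist2 f' h').
Proof.
move=> mf mf' mh mh'; rewrite /dist2.
rewrite -ge0_integralD//; do ?[exact: mdist2|by move=> *; exact: sq0].
rewrite -ge0_integralZl//; do ?[by move=> *; exact: adde_ge0|
  by apply: emeasurable_funD; exact: mdist2].
apply: ge0_le_integral => //.
- by apply: mdist2; exact: measurable_funD.
- by apply: measurable_funeM; apply: emeasurable_funD; exact: mdist2.
- move=> x _; rewrite -EFinD -EFinM lee_fin/=.
  have := sqr_ge0 ((f x - h x) - (f' x - h' x)); nra.
Qed.

Let quarter_gt0 (e : R) : (0 < e)%R -> (0 < e / 4)%R. Proof. by move=> ?; rewrite divr_gt0. Qed.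

Let approximableD f g : approximable f -> approximable g -> approximable (f \+ g)%R.
Proof.
move=> [mf fa] [mg ga]; split; first exact: measurable_funD.
move=> e e0; have [h Vh hf] := fa _ (quarter_gt0 e0); have [k Vk kg] := ga _ (quarter_gt0 e0).
exists (h \+ k)%R; first exact: VD.
apply: le_trans (dist2_add mf mg (Vm Vh) (Vm Vk)) _.
apply: (@le_trans _ _ (2%:E * ((e / 4)%:E + (e / 4)%:E))).
  by rewrite lee_wpmul2l// leeD.
by rewrite -EFinD -EFinM lee_fin; lra.
Qed.

Let approximableZ c f : approximable f -> approximable (fun x => c * f x)%R.
Proof.
move=> [mf fa]; split; first exact: measurable_funM.
(* The summand 1 covers the case c = 0. *)
move=> e e0; have c2 : (0 < c ^+ 2 + 1)%R by rewrite ltr_wpDl// sqr_ge0.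
have [|h Vh hf] := fa (e / (c ^+ 2 + 1))%R; first exact: divr_gt0.
exists (fun x => c * h x)%R; first exact: VZ.
rewrite /dist2 /=; under eq_integral do rewrite -mulrBr exprMn EFinM.
rewrite ge0_integralZl//; do ?[by apply: mdist2 => //; exact: Vm|
  by move=> *; exact: sq0|by rewrite lee_fin sqr_ge0].
apply: (@le_trans _ _ ((c ^+ 2)%:E * (e / (c ^+ 2 + 1))%:E)).
  by rewrite lee_wpmul2l// lee_fin sqr_ge0.
rewrite -EFinM lee_fin mulrCA ger_pMr// ler_pdivrMr// mul1r.
by rewrite lerDl.
Qed.

(** A nonnegative f in L2 dominates the squared error, which therefore
    vanishes in the limit by dominated convergence. *)
Let approximable_lim (f : M -> R) (f_ : nat -> M -> R) :
  measurable_fun setT f -> mu.-integrable setT (fun x => (f x ^+ 2)%:E) ->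
  (forall n, approximable (f_ n)) -> (forall n x, 0 <= f_ n x <= f x)%R ->
  (forall x, f_ n x @[n --> \oo] --> f x) -> approximable f.
Proof.
move=> mf if2 fa ff flim; split=> // e e0.
have mfn n := (fa n).1.
have cvg0 : dist2 f (f_ n) @[n --> \oo] --> 0.
  rewrite -(integral0 mu setT).
  have [] // := @dominated_convergence _ M R mu setT measurableT
    (fun n x => ((f x - f_ n x) ^+ 2)%:E) (cst 0) (fun x => (f x ^+ 2)%:E).
  - by move=> n; exact: mdist2.
  - apply: aeW => x _; apply/cvg_EFin; first exact: nearW.
    have ff0 : (f x - f_ n x)%R @[n --> \oo] --> (0%R : R).
      by rewrite -(subrr (f x)); apply: cvgB => //; exact: cvg_cst.
    rewrite -(mulr0 (0%R : R)); under eq_fun do rewrite /= expr2.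
    exact: cvgM.
  - apply: aeW => x n _ /=; have /andP[f0 fnf] := ff n x.
    by rewrite lee_fin ger0_norm ?sqr_ge0// ler_sqr ?nnegrE; lra.
(* Squared errors add up with a factor 2, whence e / 4 for each of the two. *)
have e4 := quarter_gt0 e0.
have : nbhs (0 : \bar R) [set y | y < (e / 4)%:E].
  by apply: open_nbhs_nbhs; split; [exact: open_ereal_lt_ereal|rewrite /= lte_fin].
move=> /cvg0[n _ /(_ n (leqnn n))/= fn].
have [h Vh hf] := (fa n).2 _ e4; exists h => //.
have := dist2_add mf (mfn n) (mfn n) (Vm Vh).
rewrite (_ : dist2 (f \+ f_ n)%R (f_ n \+ h)%R = dist2 f h); last first.
  by apply: eq_integral => x _; congr ((_ ^+ 2)%:E) => /=; lra.
move=> /le_trans; apply.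
apply: (@le_trans _ _ (2%:E * ((e / 4)%:E + (e / 4)%:E))).
  by rewrite lee_wpmul2l// leeD// ltW.
by rewrite -EFinD -EFinM lee_fin; lra.
Qed.

Let approximableV h : V h -> approximable h.
Proof.
move=> Vh; split=> [|e e0]; first exact: Vm.
exists h => //; rewrite /dist2; under eq_integral do rewrite subrr expr0n/=.
by rewrite integral0 lee_fin ltW.
Qed.

(** The sets with an approximable indicator form a Dynkin system: a disjoint
    union is the increasing limit of its finite subunions. *)
Let approximable_indic C : measurable C -> approximable (\1_C).
Proof.
rewrite GE; apply: (@dynkin_induction _ M G (fun C => approximable (\1_C))) => //.
- by apply/approximableV/VG.
- by move=> S GS; apply/approximableV/VG.
- move=> S mS aS.
  rewrite (_ : \1_(~` S) = \1_setT \+ (fun x => -1 * \1_S x))%R; last first.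
    by apply/funext => x; rewrite indicC/= !indicE in_setT; case: (_ \in _) => /=; lra.
  apply: approximableD; last exact: approximableZ.
  by apply/approximableV/VG.
- move=> F mF tF aF.
  have mU : measurable (\bigcup_k F k) by exact: bigcup_measurable.
  pose U n := \big[setU/set0]_(k < n) F k.
  apply: (@approximable_lim _ (fun n => \1_(U n))).
  + exact: measurable_indic.
  + apply: (eq_integrable measurableT (fun x => (\1_(\bigcup_k F k) x)%:E)).
      by move=> x _; rewrite indicE; case: (_ \in _); rewrite ?expr1n ?expr0n.
    exact: integrable_indic.
  + elim=> [|n IH].
      rewrite /U big_ord0 indic0 (_ : cst _ = (fun x => 0 * \1_setT x))%R.
        by apply: approximableZ; exact/approximableV/VG.
      by apply/funext => x; rewrite mul0r.
    rewrite /U big_ord_recr/= -/(U n).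
    rewrite (_ : \1_(U n `|` F n) = \1_(U n) \+ \1_(F n))%R; first exact: approximableD.
    apply/funext => x; have tF' : trivIset (fun i => xpredT i) F by move=> i j _ _; exact: tF.
    have /seteqP[UF _] := @trivIset_bigsetUI _ xpredT _ tF' n n isT (leqnn n).
    rewrite /= !indicE in_setU.
    have [/set_mem xU|_] := boolP (x \in U n); last by rewrite add0r.
    have [/set_mem xF|_] := boolP (x \in F n); last by rewrite addr0.
    by exfalso; apply: (UF x).
  + move=> n x; rewrite !indicE ler0n ler_nat /=.
    have [/set_mem|//] := boolP (x \in U n).
    rewrite /U -bigcup_mkord => -[k _ Fkx]; rewrite (_ : _ \in _ = true)//.
    by apply/mem_set; exists k.
  + move=> x; have [/set_mem[k _ Fkx]|nU] := boolP (x \in \bigcup_k F k).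
      apply: cvg_near_cst; exists k.+1 => //= n kn.
      rewrite !indicE !mem_set//; first by exists k.
      by rewrite /U -bigcup_mkord; exists k.
    apply: cvg_near_cst; apply: nearW => n; rewrite !indicE (negbTE nU).
    rewrite memNset// /U -bigcup_mkord => -[k _ Fkx]; move/negP: nU; apply.
    by apply/mem_set; exists k.
Qed.

Import HBNNSimple.

Let approximable_ge0 (f : M -> R) : measurable_fun setT f -> (forall x, 0 <= f x)%R ->
  mu.-integrable setT (fun x => (f x ^+ 2)%:E) -> approximable f.
Proof.
move=> mf f0 if2.
have mef : measurable_fun setT (EFin \o f) by exact/measurable_EFinP.
pose h n := nnsfun_approx measurableT mef n.
apply: (@approximable_lim _ (fun n => h n)) => //.
- move=> n.
  rewrite (_ : (h n : M -> R) = 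
      (fun x => \sum_(r <- fset_set (range (h n))) r * \1_(h n @^-1` [set r]) x))%R; last first.
    by apply/funext => x; rewrite fimfunE/= (fsbig_finite _ _ (fimfunP _)).
  elim: (enum_fset _) => [|r s IH].
    under eq_fun do rewrite big_nil.
    rewrite (_ : (fun=> _) = (fun x => 0 * \1_setT x))%R.
      by apply: approximableZ; exact/approximableV/VG.
    by apply/funext => x; rewrite mul0r.
  under eq_fun do rewrite big_cons.
  by apply: approximableD => //; apply: approximableZ; exact: approximable_indic.
- move=> n x; apply/andP; split => //.
  rewrite -lee_fin /h nnsfun_approxE.
  by apply: le_approx => //= w' _; rewrite lee_fin.
- move=> x.
  by have /fine_cvg := @cvg_nnsfun_approx _ M _ _ measurableT _ mef (fun w _ => f0 w) x I.
Qed.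

(** A vector space V of functions containing the indicators of a generating
    pi-system is dense in L2. *)
Lemma L2_approximation (f : M -> R) : measurable_fun setT f ->
  mu.-integrable setT (fun x => (f x ^+ 2)%:E) ->
  forall e : R, (0 < e)%R ->
  exists2 h, V h & \int[mu]_x ((f x - h x) ^+ 2)%:E <= e%:E.
Proof.
move=> mf if2; suff [] : approximable f by [].
pose fp x := Num.max (f x) 0%R; pose fn x := Num.max (- f x)%R 0%R.
have dom (u : M -> R) : measurable_fun setT u -> (forall x, `|u x| <= `|f x|)%R ->
    mu.-integrable setT (fun x => (u x ^+ 2)%:E).
  move=> mu' uf; apply: le_integrable if2 => //.
    by apply/measurable_EFinP; exact: measurable_funX.
  by move=> x _ /=; rewrite lee_fin !normrX lerXn2r ?nnegrE.
have mfp : measurable_fun setT fp by exact: measurable_maxr.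
have mfn : measurable_fun setT fn by apply: measurable_maxr => //; exact: measurableT_comp.
rewrite (_ : f = fp \+ (fun x => -1 * fn x))%R; last first.
  apply/funext => x; rewrite /= mulN1r /fp /fn; case: (ltP (f x) 0%R) => f0.
    by rewrite max_l ?oppr_ge0 ?ltW// add0r opprK.
  by rewrite max_r ?oppr_le0// subr0.
apply: approximableD; last apply: approximableZ.
- apply: approximable_ge0 => //; first by move=> x; rewrite le_max lexx orbT.
  by apply: dom => // x; rewrite /fp maxEle; case: ifP; rewrite ?normr0.
- apply: approximable_ge0 => //; first by move=> x; rewrite le_max lexx orbT.
  by apply: dom => // x; rewrite /fn maxEle; case: ifP; rewrite ?normr0 ?normrN.
Qed.

End L2_density.

(** * Equality of laws and product spaces *)

Section equality_of_laws.
Context d (T : measurableType d) (R : realType) (P : probability T R).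
Context d' (S : measurableType d') (G : set (set S)).
Hypotheses (GT : G setT) (GI : setI_closed G) (GE : measurable = <<s G >>).
Variables (U V : T -> S).
Hypotheses (mU : measurable_fun setT U) (mV : measurable_fun setT V)
  (UV : forall C, G C -> P (U @^-1` C) = P (V @^-1` C)).
Local Open Scope ereal_scope.

Lemma integral_eq_law (f : S -> R) : measurable_fun setT f ->
  P.-integrable setT (EFin \o (f \o U)) ->
  P.-integrable setT (EFin \o (f \o V)) /\
  \int[P]_w (f (U w))%:E = \int[P]_w (f (V w))%:E.
Proof.
move=> mf ifU.
pose U' : {RV P >-> S} := HB.pack U (isMeasurableFun.Build _ _ _ _ _ mU).
pose V' : {RV P >-> S} := HB.pack V (isMeasurableFun.Build _ _ _ _ _ mV).
have lawE C : measurable C -> distribution P U' C = distribution P V' C.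
  apply: (measure_unique G (fun=> setT)) => //.
  - by rewrite bigcup_const.
  - by move=> _; rewrite -ge0_fin_numE// fin_num_measure.
have transfer g : \int[distribution P U']_x g x = \int[distribution P V']_x g x.
  by apply: eq_measure_integral => C mC _; exact: lawE.
have mef : measurable_fun setT (EFin \o f) by exact/measurable_EFinP.
have ifV : P.-integrable setT (EFin \o (f \o V)).
  apply/integrableP; split.
    by apply/measurable_EFinP; exact: measurableT_comp.
  have /integrableP[_] := ifU; congr (_ < _).
  have mnf : measurable_fun setT (abse \o (EFin \o f)) by exact: measurableT_comp.
  transitivity (\int[distribution P U']_x (abse \o (EFin \o f)) x).
    by rewrite ge0_integral_distribution//= => x; exact: abse_ge0.
  by rewrite transfer ge0_integral_distribution//= => x; exact: abse_ge0.
split=> //.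
transitivity (\int[distribution P U']_x (f x)%:E).
  by rewrite integral_distribution.
by rewrite transfer integral_distribution.
Qed.

End equality_of_laws.

(** The left-to-right inclusion says that the identity is measurable from the
    product equipped with the sigma-algebra of the rectangles, which can be
    checked on the two coordinates. *)
Lemma measurable_prod_generated d1 d2 (S1 : measurableType d1) (S2 : measurableType d2)
    (G1 : set (set S1)) (G2 : set (set S2)) :
  measurable = <<s G1 >> -> measurable = <<s G2 >> -> G1 setT -> G2 setT ->
  @measurable _ (S1 * S2)%type = <<s [set C1 `*` C2 | C1 in G1 & C2 in G2] >>.
Proof.
move=> G1E G2E G1T G2T; set G := (G in <<s G >>).
apply/seteqP; split.
  pose SG := g_sigma_algebraType (G : set (set (S1 * S2)%type)).
  have mfst : measurable_fun setT (fst : SG -> S1).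
    apply: (measurability G1) => // _ [C GC <-]; rewrite setTI.
    by apply: sub_gen_smallest; exists C => //; exists setT => //; rewrite setXT.
  have msnd : measurable_fun setT (snd : SG -> S2).
    apply: (measurability G2) => // _ [C GC <-]; rewrite setTI.
    by apply: sub_gen_smallest; exists setT => //; exists C => //; rewrite setTX.
  have mid : measurable_fun setT (fun x : SG => (x.1, x.2) : S1 * S2).
    exact: measurable_fun_pair.
  move=> C mC; have := mid measurableT C mC; rewrite setTI.
  by congr (<<s G >> _); apply/seteqP; split => -[].
apply: smallest_sub; first exact: sigma_algebra_measurable.
move=> _ [C1 GC1 [C2 GC2 <-]]; apply: measurableX.
  by rewrite G1E; exact: sub_gen_smallest.
by rewrite G2E; exact: sub_gen_smallest.
Qed.

Section product_space.
Context (A : countType) (E : A -> ptopologicalType).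

Lemma measurable_coordinate a :
  measurable_fun setT (fun x : prod_space E => (x a : borel (E a))).
Proof.
move=> _ B mB; apply: sub_gen_smallest; exists a => //.
by exists B.
Qed.

Lemma measurable_fun_coordinates d (T : measurableType d) (f : T -> prod_space E) :
  (forall a, measurable_fun setT (fun w => f w a : borel (E a))) ->
  measurable_fun setT f.
Proof.
move=> mf; apply: (@measurability _ _ T (prod_space E) setT f (@coord_sets A E)) => //.
move=> _ [C [a _ [B mB <-]] <-].
by rewrite !setTI; have := mf a measurableT B mB; rewrite setTI.
Qed.

Definition box (B : forall a, set (borel (E a))) : set (prod_space E) :=
  [set x | forall a, B a (x a)].

Lemma measurable_box B : (forall a, measurable (B a)) -> measurable (box B).
Proof.
move=> mB; rewrite (_ : box B = \bigcap_(a in setT) [set x | B a (x a)]).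
  rewrite -[X in measurable X]setCK setC_bigcap; apply: measurableC.
  apply: countable_bigcupT_measurable => [|a]; first exact: countableP.
  apply: measurableC; rewrite -[X in measurable X]setTI.
  exact: (@measurable_coordinate a).
by apply/seteqP; split=> [x xB a _|x xB a]; [exact: xB|exact: (xB a I)].
Qed.

(** The boxes with finitely many nontrivial sides: unlike arbitrary boxes they
    have indicators depending on finitely many coordinates, which is what the
    induction over coordinates requires. *)
Definition cylinders : set (set (prod_space E)) :=
  [set box B | B in [set B | (forall a, measurable (B a)) /\
    exists s : seq A, forall a, a \notin s -> B a = setT]].

Lemma cylindersT : cylinders setT.
Proof.
exists (fun a => setT); last by apply/seteqP; split.
by split => //; exists [::].
Qed.

Lemma cylinders_setI : setI_closed cylinders.
Proof.
move=> _ _ [B [mB [s sB]] <-] [B' [mB' [s' sB']] <-].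
exists (fun a => B a `&` B' a); last first.
  apply/seteqP; split => [x BB'|x [xB xB'] a]; last by split.
  by split => a; have [] := BB' a.
split=> [a|]; first exact: measurableI.
exists (s ++ s') => a; rewrite mem_cat negb_or => /andP[/sB -> /sB' ->].
by rewrite setTI.
Qed.

Lemma cylindersE : measurable = <<s cylinders >>.
Proof.
apply/seteqP; split; last first.
  apply: smallest_sub; first exact: sigma_algebra_measurable.
  by move=> _ [B [mB _] <-]; exact: measurable_box.
apply: sub_sigma_algebra2 => _ [a _ [B mB <-]].
exists (@dfwith A (fun b => set (borel (E b))) (fun=> setT) a B).
  split => [b|].
    by case: dfwithP => //; exact: measurableT.
  by exists [:: a] => b; rewrite inE; case: dfwithP => //; rewrite eqxx.
apply/seteqP; split => x; first by move=> /(_ a); rewrite dfwithin.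
by move=> [_ xB] b; case: dfwithP.
Qed.

End product_space.

(** * Conditionally independent families *)

Section conditionally_independent_family.
Context d (T : measurableType d) (R : realType) (P : probability T R).
Context (A : countType) (E0 : ptopologicalType) (E : A -> ptopologicalType).
Variables (Z : {RV P >-> borel E0}) (X X' : forall a, {RV P >-> borel (E a)}).
Hypotheses (indepX : cond_independent Z X) (copyX' : cond_independent_copy Z X X').

Local Notation GZ := (sigma_of Z).
Local Notation Goff a := (sigma_fam X [set b | b != a] `|` sigma_of Z).
Local Notation GXZ := (sigma_fam X setT `|` sigma_of Z).
Local Notation TZ := (g_sigma_algebraType GZ).

Let GZ_measurable : GZ `<=` measurable.
Proof. by move=> _ [B mB <-]; exact: measurable_funP. Qed.

Let sigma_fam_measurable D : sigma_fam X D `|` GZ `<=` measurable.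
Proof.
by move=> S [|/GZ_measurable//] [a _ [B mB <-]]; exact: measurable_funP.
Qed.

Let GZ_sub D : <<s GZ >> `<=` <<s sigma_fam X D `|` GZ >>.
Proof. by apply: sub_sigma_algebra2; exact: subsetUr. Qed.

Let Goff_sub a : <<s Goff a >> `<=` <<s GXZ >>.
Proof.
by apply: sub_sigma_algebra2 => S [[b _ Sb]|]; [left; exists b|right].
Qed.

Local Open Scope ereal_scope.

Let condlawP d' (S : measurableType d') (Y : {RV P >-> S}) (G : set (set T)) B :
  G `<=` measurable -> measurable B ->
  measurable_fun setT (condlaw P G Y ^~ B : g_sigma_algebraType G -> \bar R) /\
  forall C, <<s G >> C -> \int[P]_(w in C) condlaw P G Y w B = P (Y @^-1` B `&` C).
Proof.
move=> Gm mB.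
have mYB : measurable (Y @^-1` B) by rewrite -[X in measurable X]setTI; exact: measurable_funP.
have cY : is_condexp P G (fun w => (\1_(Y @^-1` B) w)%:E) (condlaw P G Y ^~ B).
  by apply: condexpP_ge0 => //; exact/measurable_EFinP.
split; first exact: condexp_measurable cY.
move=> C GC; rewrite (cY.2 C GC) integral_indic//; exact: sub_measurable GC.
Qed.

(** The common conditional probability of [X a \in B] and [X' a \in B] given
    [Z], as a genuinely bounded function: the conditional laws are only known to
    lie in [0, 1] almost surely. *)
Lemma conditional_probability a (B : set (borel (E a))) : measurable B ->
  exists p : T -> R, [/\ measurable_fun setT (p : TZ -> R),
    forall w, (0 <= p w <= 1)%R,
    forall C, <<s Goff a >> C -> P (X a @^-1` B `&` C) = \int[P]_(w in C) (p w)%:E &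
    forall C, <<s GXZ >> C -> P (X' a @^-1` B `&` C) = \int[P]_(w in C) (p w)%:E].
Proof.
move=> mB; pose q := condlaw P GZ (X a) ^~ B.
have [mq qE] := condlawP (X a) GZ_measurable mB.
have mq' := sub_measurable_fun GZ_measurable mq.
have mXB : measurable (X a @^-1` B) by rewrite -[X in measurable X]setTI; exact: measurable_funP.
have m1 : measurable_fun setT (fun w => (\1_(X a @^-1` B) w)%:E : \bar R).
  by apply/measurable_EFinP; exact: measurable_indic.
have q_ge0 : {ae P, forall w, 0 <= q w} by exact: condexp_ae_ge0.
have iq : P.-integrable setT q.
  by apply: condexp_integrable => //; exact: integrable_indic.
have q_le1 : {ae P, forall w, q w <= 1}.
  apply: (ae_le_of_integrals GZ_measurable (V := cst 1)) => // S GS.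
  have mS := sub_measurable GZ_measurable GS.
  by rewrite qE// integral_cst// mul1e measureIr.
pose p w := Num.max 0%R (Num.min 1%R (fine (q w))).
have mp : measurable_fun setT (p : TZ -> R).
  apply: measurable_maxr => //; apply: measurable_minr => //.
  by apply: measurableT_comp => //; exact: measurable_fine.
have mp' : measurable_fun setT (EFin \o p).
  by apply/measurable_EFinP; exact: sub_measurable_fun mp.
have pq : {ae P, forall w, q w = (p w)%:E}.
  move: q_ge0 q_le1; apply: filterS2 => w q0 q1.
  have qf : q w \is a fin_num by rewrite ge0_fin_numE// (le_lt_trans q1) ?ltry.
  rewrite /p -[LHS]fineK//; congr EFin.
  by move: q0 q1; rewrite -(fineK qf) !lee_fin/= => q0 q1; rewrite min_r// max_r.
exists p; split => //.
- by move=> w; rewrite le_max lexx/= ge_max ler01/= ge_min lexx.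
- move=> C GC; have mC := sub_measurable (@sigma_fam_measurable _) GC.
  have [mr rE] := condlawP (X a) (@sigma_fam_measurable [set b | b != a]) mB.
  have mr' := sub_measurable_fun (@sigma_fam_measurable _) mr.
  rewrite -rE//; apply: ae_eq_integral => //; [exact: measurable_funTS|exact: measurable_funTS|].
  by move: (@indepX a B mB) pq; apply: filterS2 => w -> + _.
- move=> C GC; have mC := sub_measurable (@sigma_fam_measurable _) GC.
  have [mr rE] := condlawP (X' a) (@sigma_fam_measurable setT) mB.
  have mr' := sub_measurable_fun (@sigma_fam_measurable _) mr.
  rewrite -rE//; apply: ae_eq_integral => //; [exact: measurable_funTS|exact: measurable_funTS|].
  have [/(_ _ mB) law1 /(_ _ mB) law2] := copyX' a.
  by move: law1 law2 pq; apply: filterS3 => w l1 l2 qp _; rewrite l2 l1.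
Qed.

Local Notation M := (prod_space E * TZ)%type.
(** The second component is the sample point, but only seen through the
    sigma-algebra of Z: a Z-measurable function on T is then literally a
    measurable function of it, without Doob-Dynkin factorisation. *)
Let J (w : T) : M := (joint X w, w).
Let Ja a (w : T) : M := (resample X X' a w, w).

Let X_preimage D a B : D a -> measurable B -> <<s sigma_fam X D `|` GZ >> (X a @^-1` B).
Proof.
by move=> Da mB; apply: sub_gen_smallest; left; exists a => //; exists B => //; rewrite setTI.
Qed.

Let measurable_J : measurable_fun setT (J : g_sigma_algebraType GXZ -> M).
Proof.
apply: measurable_fun_pair.
  apply: measurable_fun_coordinates => a _ B mB.
  by rewrite setTI; exact: X_preimage.
by move=> _ S mS; rewrite setTI; exact: GZ_sub.
Qed.

Let measurable_J' : measurable_fun setT J.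
Proof. exact: (sub_measurable_fun (@sigma_fam_measurable _) measurable_J). Qed.

Let measurable_Ja a : measurable_fun setT (Ja a).
Proof.
apply: measurable_fun_pair.
  apply: measurable_fun_coordinates => b; rewrite /resample.
  have [->|ba] := eqVneq b a.
    rewrite (_ : (fun w => _) = X' a)//.
    by apply/funext => w; rewrite dfwithin.
  rewrite (_ : (fun w => _) = X b)//.
  by apply/funext => w; rewrite dfwithout// eq_sym.
by move=> _ S mS; rewrite setTI; exact: sub_measurable GZ_measurable _ mS.
Qed.

Let box_event (a : A) (B : forall b, set (borel (E b))) : (forall b, measurable (B b)) ->
  <<s Goff a >> [set w | forall b, b != a -> B b (X b w)].
Proof.
move=> mB; rewrite (_ : mkset _ = \bigcap_(b in [set: A]) [set w | b != a -> B b (X b w)]).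
  rewrite -[X in <<s _ >> X]setCK setC_bigcap.
  apply: (@measurableC _ (g_sigma_algebraType (Goff a))).
  apply: (@countable_bigcupT_measurable _ (g_sigma_algebraType (Goff a))) => [|b].
    exact: countableP.
  apply: (@measurableC _ (g_sigma_algebraType (Goff a))).
  have [->|ba] := eqVneq b a.
    rewrite (_ : mkset _ = [set: T]); last by apply/seteqP.
    exact: (@measurableT _ (g_sigma_algebraType (Goff a))).
  rewrite (_ : mkset _ = X b @^-1` B b); first exact: X_preimage.
  by apply/seteqP; split => [w /(_ isT)|w + _].
by apply/seteqP; split=> [w wB b _|w wB b]; [exact: wB|exact: (wB b I)].
Qed.

Local Notation ind S := (\1_S : T -> R).

(** Given [Z], both [X a] and [X' a] have the conditional law of [X a], and they
    are independent of each other and of the other coordinates. Conditioning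
    first on all of X and Z replaces the event on [X' a] by q; conditioning then
    on the other coordinates and Z replaces the event on [X a] by p. *)
Let pair_probability a (B C : set (borel (E a))) (p q : T -> R) (D : set T) :
  measurable B ->
  measurable_fun setT (p : TZ -> R) -> (forall w, 0 <= p w <= 1)%R ->
  measurable_fun setT (q : TZ -> R) -> (forall w, 0 <= q w <= 1)%R ->
  (forall S, <<s Goff a >> S -> P (X a @^-1` B `&` S) = \int[P]_(w in S) (p w)%:E) ->
  (forall S, <<s GXZ >> S -> P (X' a @^-1` C `&` S) = \int[P]_(w in S) (q w)%:E) ->
  <<s Goff a >> D ->
  P (X' a @^-1` C `&` (X a @^-1` B `&` D)) = \int[P]_(w in D) (p w * q w)%:E.
Proof.
move=> mB mp p01 mq q01 pE qE GD.
have mXB : measurable (X a @^-1` B) by rewrite -[X in measurable X]setTI; exact: measurable_funP.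
have Goffm := @sigma_fam_measurable [set b | b != a].
have mD := sub_measurable Goffm GD.
have GXZ_D : <<s GXZ >> (X a @^-1` B `&` D).
  by apply: (@measurableI _ (g_sigma_algebraType GXZ)); [exact: X_preimage|exact: (Goff_sub GD)].
have mp' := sub_measurable_fun GZ_measurable mp.
have mq' := sub_measurable_fun GZ_measurable mq.
have mqD : measurable_fun setT (q \* \1_D : g_sigma_algebraType (Goff a) -> R)%R.
  apply: measurable_funM; last exact: (@measurable_indic _ (g_sigma_algebraType (Goff a))).
  by move=> _ S mS; have := mq measurableT S mS; rewrite !setTI; exact: GZ_sub.
have ib (u : T -> R) : measurable_fun setT u -> (forall w, `|u w| <= 1)%R ->
    P.-integrable setT (EFin \o u).
  move=> mu u1; apply: (@le_integrable _ _ _ P setT _ _ (cst 1)) => //.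
  - exact/measurable_EFinP.
  - by move=> w _ /=; rewrite lee_fin normr1.
  - exact: (@finite_measure_integrable_cst _ _ _ P _).
have indic01 (S : set T) w : (0 <= ind S w <= 1)%R.
  by rewrite indicE ler0n lern1 leq_b1.
rewrite (qE _ GXZ_D) integral_mkcond [RHS]integral_mkcond.
under eq_integral do rewrite epatch_indic/= -EFinM.
under [RHS]eq_integral do rewrite epatch_indic/= -EFinM.
have mb (u v : T -> R) w : (0 <= u w <= 1 -> 0 <= v w <= 1 -> 0 <= u w * v w <= 1)%R.
  by move=> /andP[u0 u1] /andP[v0 v1]; rewrite mulr_ge0// mulr_ile1.
have norm1 (x : R) : (0 <= x <= 1)%R -> (`|x| <= 1)%R.
  by move=> /andP[x0 x1]; rewrite ger0_norm.
have i1 : P.-integrable setT (EFin \o (fun w => q w * ind (X a @^-1` B `&` D) w))%R.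
  apply: ib => [|w]; first apply: measurable_funM => //.
    by apply: measurable_indic; exact: measurableI.
  by apply: norm1; exact: (mb q).
have i2 : P.-integrable setT (EFin \o (fun w => p w * q w * ind D w))%R.
  apply: ib => [|w]; first by do 2?apply: measurable_funM.
  by apply: norm1; apply: (mb (p \* q)%R) => //; exact: mb.
have ip : P.-integrable setT (EFin \o p) by apply: ib => // w; exact: norm1.
have i3 := integrable_indic P mXB.
have fE : (EFin \o (ind (X a @^-1` B) \- p)%R) =
    (fun w => (ind (X a @^-1` B) w)%:E) \- (EFin \o p) by [].
have vfE : (EFin \o ((q \* \1_D) \* (ind (X a @^-1` B) \- p))%R) =
    (EFin \o (fun w => q w * ind (X a @^-1` B `&` D) w)%R) \-
    (EFin \o (fun w => p w * q w * ind D w)%R).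
  by apply/funext => w; rewrite /= -EFinB indicI/=; congr EFin; ring.
have i4 : P.-integrable setT (EFin \o (ind (X a @^-1` B) \- p))%R.
  by rewrite fE; exact: integrableB.
have f0 S : <<s Goff a >> S ->
    \int[P]_(w in S) ((ind (X a @^-1` B) \- p) w)%R%:E = 0.
  move=> GS; have mS := sub_measurable Goffm GS.
  under eq_integral do rewrite /= EFinB.
  rewrite integralB//; [|exact: integrableS i3|exact: integrableS ip].
  have -> : \int[P]_(w in S) (ind (X a @^-1` B) w)%:E = \int[P]_(w in S) (p w)%:E.
    by rewrite integral_indic//; exact: pE.
  by rewrite subee// integrable_fin_num//; exact: integrableS ip.
have i5 : P.-integrable setT
    (EFin \o ((q \* \1_D) \* (ind (X a @^-1` B) \- p))%R).
  by rewrite vfE; exact: integrableB.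
have := integral_pullout Goffm i4 f0 mqD i5.
rewrite (_ : \int[P]_w _ = \int[P]_w ((EFin \o (fun w => q w * ind (X a @^-1` B `&` D) w)%R) w -
    (EFin \o (fun w => p w * q w * ind D w)%R) w)); last first.
  by apply: eq_integral => w _; have := congr1 (@^~ w) vfE.
rewrite integralB// => /eqP; rewrite sube_eq ?add0e ?integrable_fin_num//.
  by move=> /eqP.
Qed.

(** The integrand of [pair_probability] is symmetric in B and C. *)
Let swap_probability a (B C : set (borel (E a))) (D : set T) :
  measurable B -> measurable C -> <<s Goff a >> D ->
  P (X' a @^-1` C `&` (X a @^-1` B `&` D)) = P (X' a @^-1` B `&` (X a @^-1` C `&` D)).
Proof.
move=> mB mC GD.
have [p [mp p01 pE pE']] := conditional_probability mB.
have [q [mq q01 qE qE']] := conditional_probability mC.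
rewrite (pair_probability mB mp p01 mq q01 pE qE' GD).
rewrite (pair_probability mC mq q01 mp p01 qE pE' GD).
by apply: eq_integral => w _; rewrite mulrC.
Qed.

Let boxes : set (set M) := [set C `*` S | C in @cylinders A E & S in @measurable _ TZ].

Let boxesT : boxes setT.
Proof. by exists setT; [exact: cylindersT|exists setT => //; rewrite setXTT]. Qed.

Let boxes_setI : setI_closed boxes.
Proof.
move=> _ _ [C cC [S mS <-]] [C' cC' [S' mS' <-]]; rewrite -setXI.
by exists (C `&` C'); [exact: cylinders_setI|exists (S `&` S') => //; exact: measurableI].
Qed.

Let boxesE : measurable = <<s boxes >>.
Proof.
apply: measurable_prod_generated => //; [exact: cylindersE| |exact: cylindersT].
by rewrite sigma_algebra_id//; exact: sigma_algebra_measurable.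
Qed.

Let pair_event a (B1 B2 : forall b, set (borel (E b))) w :
  (box B1 (joint X w) /\ box B2 (resample X X' a w)) <->
  [/\ B2 a (X' a w), B1 a (X a w) & forall b, b != a -> (B1 b `&` B2 b) (X b w)].
Proof.
split=> [[XB1 XB2]|[XB2 XB1 XB]].
  split; [by have := XB2 a; rewrite /resample dfwithin|exact: XB1|].
  move=> b ba; split; first exact: XB1.
  by have := XB2 b; rewrite /resample dfwithout// eq_sym.
split=> b; have [->//|ba] := eqVneq b a; first by have [] := XB b ba.
- by rewrite /resample dfwithin.
- by rewrite /resample dfwithout 1?eq_sym//; have [] := XB b ba.
Qed.

(** The pairs (X, resampled X) and (resampled X, X) have the same law, jointly
    with Z. On rectangles of boxes this is [swap_probability], the coordinates
    other than a being common to both families. *)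
Let exchange a (f : M * M -> R) : measurable_fun setT f ->
  P.-integrable setT (fun w => (f (J w, Ja a w))%:E) ->
  P.-integrable setT (fun w => (f (Ja a w, J w))%:E) /\
  \int[P]_w (f (J w, Ja a w))%:E = \int[P]_w (f (Ja a w, J w))%:E.
Proof.
move=> mf.
apply: (@integral_eq_law _ T R P _ (M * M)%type [set C1 `*` C2 | C1 in boxes & C2 in boxes]
  _ _ _ (fun w => (J w, Ja a w)) (fun w => (Ja a w, J w))) => //.
- by exists setT => //; exists setT => //; rewrite setXTT.
- move=> _ _ [C bC [D bD <-]] [C' bC' [D' bD' <-]]; rewrite -setXI.
  by exists (C `&` C'); [exact: boxes_setI|exists (D `&` D') => //; exact: boxes_setI].
- by apply: measurable_prod_generated.
- exact: measurable_fun_pair.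
- exact: measurable_fun_pair.
- move=> _ [_ [_ [B1 [mB1 _] <-] [S1 mS1 <-]] [_ [_ [B2 [mB2 _] <-] [S2 mS2 <-]] <-]].
  pose D := (S1 `&` S2) `&` [set w | forall b, b != a -> (B1 b `&` B2 b) (X b w)].
  have GD : <<s Goff a >> D.
    apply: (@measurableI _ (g_sigma_algebraType (Goff a))).
      by apply: (@measurableI _ (g_sigma_algebraType (Goff a))); exact: GZ_sub.
    by apply: (@box_event a (fun b => B1 b `&` B2 b)) => b; exact: measurableI.
  transitivity (P (X' a @^-1` B2 a `&` (X a @^-1` B1 a `&` D))).
    congr (P _); apply/seteqP; split => w /=.
      move=> [[b1 s1] [b2 s2]].
      by have /pair_event[] : box B1 (joint X w) /\ box B2 (resample X X' a w) by split.
    move=> [xb2 [xb1 [[s1 s2] xb]]].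
    by have /pair_event[] := And3 xb2 xb1 xb.
  rewrite (swap_probability (mB1 a) (mB2 a) GD).
  congr (P _); apply/seteqP; split => w /=.
    move=> [xb1 [xb2 [[s1 s2] xb]]].
    have /pair_event[] : [/\ B1 a (X' a w), B2 a (X a w) &
      forall b, b != a -> (B2 b `&` B1 b) (X b w)] by split => // b /xb[].
    by [].
  move=> [[b1 s1] [b2 s2]].
  have /pair_event[xb1 xb2 xb] : box B2 (joint X w) /\ box B1 (resample X X' a w) by split.
  by split => //; split => //; split => // b /xb[].
Qed.

Local Close Scope ereal_scope.

(** The test functions: finite sums of bounded functions of Z times indicators
    of boxes whose sides are nontrivial only in s. Factors depending on Z are
    needed because averaging a coordinate out produces them. *)
Inductive cylindrical (s : seq A) : (M -> R) -> Prop :=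
| cylindrical0 : cylindrical s (fun=> 0)
| cylindricalD (g : T -> R) (K : R) (B : forall a, set (borel (E a))) (h : M -> R) :
    measurable_fun setT (g : TZ -> R) -> (forall w, `|g w| <= K) ->
    (forall a, measurable (B a)) -> (forall a, a \notin s -> B a = setT) ->
    cylindrical s h ->
    cylindrical s (fun m => g m.2 * \1_(box B) m.1 + h m).

Let measurable_term (g : T -> R) (B : forall a, set (borel (E a))) :
  measurable_fun setT (g : TZ -> R) -> (forall a, measurable (B a)) ->
  measurable_fun setT (fun m : M => g m.2 * \1_(box B) m.1).
Proof.
move=> mg mB; apply: measurable_funM; first exact: measurableT_comp mg _.
have mb : measurable_fun setT (\1_(box B) : prod_space E -> R).
  by apply: measurable_indic; exact: measurable_box.
exact: measurableT_comp mb _.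
Qed.

Let cylindrical_measurable s h : cylindrical s h -> measurable_fun setT h.
Proof.
by elim=> // g K B k mg gK mB sB ck mk; apply: measurable_funD => //; exact: measurable_term.
Qed.

Let cylindrical_bounded s h : cylindrical s h -> exists K, forall m, `|h m| <= K.
Proof.
elim=> [|g K B k mg gK mB sB ck [K' kK']]; first by exists 0 => m; rewrite normr0.
exists (K + K') => m; rewrite (le_trans (ler_normD _ _))// lerD// normrM.
by rewrite -[leRHS]mulr1 ler_pM// indicE; case: (_ \in _); rewrite ?normr1 ?normr0//.
Qed.

Let cylindrical_sqint s h (U : T -> M) : measurable_fun setT U -> cylindrical s h ->
  square_integrable P (h \o U).
Proof.
move=> mU ch; have [K hK] := cylindrical_bounded ch.
apply: (@square_integrable_bounded _ _ _ _ _ K) => [|w]; last exact: hK.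
apply: measurableT_comp => //; exact: cylindrical_measurable ch.
Qed.

Let cylindrical_add s h k : cylindrical s h -> cylindrical s k -> cylindrical s (h \+ k).
Proof.
move=> ch ck; elim: ch => [|g K B h' mg gK mB sB _ IH].
  by rewrite (_ : _ \+ _ = k)//; apply/funext => m /=; rewrite add0r.
rewrite (_ : _ \+ _ = fun m => g m.2 * \1_(box B) m.1 + (h' \+ k) m).
  exact: cylindricalD mg gK mB sB IH.
by apply/funext => m /=; rewrite addrA.
Qed.

Let cylindrical_scale s c h : cylindrical s h -> cylindrical s (fun m => c * h m).
Proof.
elim=> [|g K B h' mg gK mB sB _ IH].
  by rewrite (_ : (fun m => _) = fun=> 0)//; [exact: cylindrical0|apply/funext => m; rewrite mulr0].
rewrite (_ : (fun m => _) = fun m => (c * g m.2) * \1_(box B) m.1 + c * h' m); last first.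
  by apply/funext => m; rewrite mulrDr mulrA.
apply: (@cylindricalD s (fun w => c * g w) (`|c| * K)) => //.
  exact: measurable_funM.
by move=> w; rewrite normrM ler_wpM2l.
Qed.

Let cylindrical_sub s s' h : {subset s <= s'} -> cylindrical s h -> cylindrical s' h.
Proof.
move=> ss'; elim=> [|g K B h' mg gK mB sB _ IH]; first exact: cylindrical0.
by apply: cylindricalD mg gK mB _ IH => a as'; apply: sB; apply: contra as'; exact: ss'.
Qed.

Let cylindrical_nil h : cylindrical [::] h -> exists g : T -> R,
  [/\ measurable_fun setT (g : TZ -> R), exists K, forall w, `|g w| <= K &
      forall m, h m = g m.2].
Proof.
elim=> [|g K B h' mg gK mB sB _ [g' [mg' [K' gK'] h'E]]].
  by exists (fun=> 0); split => //; exists 0 => w; rewrite normr0.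
exists (g \+ g'); split; first exact: measurable_funD.
  by exists (K + K') => w; rewrite (le_trans (ler_normD _ _))// lerD.
move=> m; rewrite h'E indicE mem_set ?mulr1// => a.
by rewrite sB.
Qed.

Let cylindrical_resample s a h w : a \notin s -> cylindrical s h -> h (Ja a w) = h (J w).
Proof.
move=> nas; elim=> // g K B h' mg gK mB sB _ ->; congr (_ * _ + _).
rewrite !indicE; congr (nat_of_bool _)%:R; apply/idP/idP => /set_mem xB; apply/mem_set => b /=.
  have [->|ba] := eqVneq b a; first by rewrite sB.
  by have := xB b; rewrite /= /resample dfwithout 1?eq_sym.
have [->|ba] := eqVneq b a; first by rewrite sB.
by rewrite /resample dfwithout 1?eq_sym//; exact: xB.
Qed.

(** Given X and Z, the event [X' a \in B a] may be replaced by its conditional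
    probability p given Z: in each term of h the side of the box in direction a
    is dropped and its coefficient is multiplied by p. *)
Let averaging a s h : cylindrical (a :: s) h -> exists2 k, cylindrical s k &
  forall u : M -> R, measurable_fun setT u -> square_integrable P (u \o J) ->
  inner P (u \o J) (h \o Ja a) = inner P (u \o J) (k \o J).
Proof.
elim=> [|g K B h' mg gK mB sB ch' [k ck hk]].
  by exists (fun=> 0) => //; exact: cylindrical0.
have [p [mp p01 _ pE]] := conditional_probability (mB a).
pose B' := @dfwith A (fun b => set (borel (E b))) B a setT.
have mB' b : measurable (B' b) by rewrite /B'; case: dfwithP.
have mg' := sub_measurable_fun GZ_measurable mg.
have mp' := sub_measurable_fun GZ_measurable mp.
have K0 : 0 <= K by rewrite (le_trans _ (gK point)).
have gpK w : `|(g \* p) w| <= K.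
  rewrite /= normrM -[leRHS]mulr1 ler_pM//.
  by have /andP[p0 p1] := p01 w; rewrite ger0_norm.
have cgp : cylindrical s (fun m => (g \* p) m.2 * \1_(box B') m.1 + k m).
  apply: (cylindricalD (K := K)) => //; first exact: measurable_funM.
  move=> b; rewrite /B'; case: dfwithP => // c ac cs.
  by apply: sB; rewrite inE negb_or cs eq_sym ac.
exists (fun m => (g \* p) m.2 * \1_(box B') m.1 + k m) => //.
move=> u mu iu.
pose v w : R := g w * \1_(box B') (joint X w).
have vK w : `|v w| <= K.
  rewrite normrM -[leRHS]mulr1 ler_pM//.
  by rewrite indicE; case: (_ \in _); rewrite ?normr1 ?normr0.
have mv : measurable_fun setT (v : g_sigma_algebraType GXZ -> R).
  exact: (measurableT_comp (measurable_term mg mB') measurable_J).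
have mv' := sub_measurable_fun (@sigma_fam_measurable _) mv.
pose e := (\1_(X' a @^-1` B a) : T -> R).
have hE w : g w * \1_(box B) (resample X X' a w) = v w * e w.
  rewrite /v /e -mulrA; congr (_ * _).
  rewrite !indicE -natrM mulnb; congr (nat_of_bool _)%:R.
  apply/idP/andP => [/set_mem xB|[/set_mem xB /set_mem xBa]].
    split; apply/mem_set.
      move=> b; rewrite /B'; case: dfwithP => // c ac.
      by have := xB c; rewrite /resample dfwithout.
    by have := xB a; rewrite /resample dfwithin.
  apply/mem_set => b; rewrite /resample; case: dfwithP => // c ac.
  by have := xB c; rewrite /B' dfwithout.
have mXa : measurable (X' a @^-1` B a).
  by rewrite -[X in measurable X]setTI; exact: measurable_funP.
have me : measurable_fun setT e.
  exact: measurable_indic.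
have ie : square_integrable P e.
  apply: (@square_integrable_bounded _ _ _ _ _ 1) => [|w] //.
  by rewrite /e indicE; case: (_ \in _); rewrite ?normr1 ?normr0.
have ip : square_integrable P p.
  apply: (@square_integrable_bounded _ _ _ _ _ 1) => [|w] //.
  by have /andP[p0 p1] := p01 w; rewrite ger0_norm.
have iv : square_integrable P v by exact: square_integrable_bounded vK.
have iuv : square_integrable P ((u \o J) \* v) by exact: square_integrableM vK.
have ive : square_integrable P (v \* e).
  apply: (square_integrableM (K := 1)) => // w.
  by rewrite /e indicE; case: (_ \in _); rewrite ?normr1 ?normr0.
have ivp : square_integrable P (v \* p).
  apply: (square_integrableM (K := 1)) => // w.
  by have /andP[p0 p1] := p01 w; rewrite ger0_norm.
have core : inner P (u \o J) (v \* e) = inner P (u \o J) (v \* p).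
  pose uv := (u \o J) \* v.
  have moveE (t : T -> R) : inner P (u \o J) (v \* t) = inner P uv t.
    by apply: eq_Rintegral => w _ /=; rewrite mulrA.
  apply/eqP; rewrite -subr_eq0 !moveE -innerBr//; apply/eqP.
  have iie : P.-integrable setT (EFin \o e).
    exact: integrable_indic.
  have iip := integrable_square ip.
  rewrite /inner /Rintegral (integral_pullout (@sigma_fam_measurable setT))//.
  - by have := integrableB measurableT iie iip.
  - move=> S GS; have mS := sub_measurable (@sigma_fam_measurable _) GS.
    under eq_integral do rewrite /= EFinB.
    rewrite integralB//; [|exact: integrableS iie|exact: integrableS iip].
    have -> : (\int[P]_(w in S) (e w)%:E = \int[P]_(w in S) (p w)%:E)%E.
      by rewrite integral_indic//; exact: pE.
    by rewrite subee// integrable_fin_num//; exact: integrableS iip.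
  - apply: measurable_funM => //.
    exact: (measurableT_comp mu measurable_J).
  - apply: integrable_mul_square => //; exact: square_integrableB.
rewrite (_ : (fun m => _) \o Ja a = (v \* e) \+ (h' \o Ja a)); last first.
  by apply/funext => w /=; rewrite hE.
rewrite (_ : (fun m => _ + _) \o J = (v \* p) \+ (k \o J)); last first.
  by apply/funext => w /=; congr (_ + _); rewrite /v mulrAC.
rewrite !(innerC P (u \o J)) !innerDl//.
- by rewrite !(innerC P _ (u \o J)) core hk.
- exact: cylindrical_sqint ck.
- exact: cylindrical_sqint ch'.
Qed.

(** * The inequality for functions of X and Z *)

Let square_integrable_resample a (u : M -> R) : measurable_fun setT u ->
  square_integrable P (u \o J) -> square_integrable P (u \o Ja a).
Proof.
move=> mu [_ iu]; split; first exact: (measurableT_comp mu (measurable_Ja a)).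
have mf : measurable_fun setT (fun x : M * M => u x.1 ^+ 2).
  by apply: measurable_funX; exact: (measurableT_comp mu measurable_fst).
by have [] := @exchange a _ mf iu.
Qed.

Let inner_exchange a (u v : M -> R) : measurable_fun setT u -> measurable_fun setT v ->
  square_integrable P (u \o J) -> square_integrable P (v \o J) ->
  inner P (u \o J) (v \o Ja a) = inner P (u \o Ja a) (v \o J).
Proof.
move=> mu mv iu iv; have iv' := square_integrable_resample a mv iv.
have mf : measurable_fun setT (fun x : M * M => u x.1 * v x.2).
  apply: measurable_funM; first exact: (measurableT_comp mu measurable_fst).
  exact: (measurableT_comp mv measurable_snd).
have [] := @exchange a _ mf; first exact: integrable_mul_square iu iv'.
by move=> _ e; rewrite /inner /Rintegral e.
Qed.

Let inner_resample a (u v : M -> R) : measurable_fun setT u -> measurable_fun setT v ->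
  square_integrable P (u \o J) -> square_integrable P (v \o J) ->
  inner P (u \o J) (v \o J) = inner P (u \o Ja a) (v \o Ja a).
Proof.
move=> mu mv iu iv.
have mf : measurable_fun setT (fun x : M * M => u x.1 * v x.1).
  apply: measurable_funM; first exact: (measurableT_comp mu measurable_fst).
  exact: (measurableT_comp mv measurable_fst).
have [] := @exchange a _ mf; first exact: integrable_mul_square iu iv.
by move=> _ e; rewrite /inner /Rintegral e.
Qed.

Let energy (F : M -> R) a : R :=
  inner P ((F \o J) \- (F \o Ja a)) ((F \o J) \- (F \o Ja a)).

(** The integrated inequality 0 <= ((f - f_a) - (h - h_a))^2, with f = F(J) and
    with all mixed terms evaluated by [averaging] and exchangeability. *)
Let efron_stein_step (F : M -> R) a s h : measurable_fun setT F ->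
  square_integrable P (F \o J) -> a \notin s -> cylindrical (a :: s) h ->
  exists2 k, cylindrical s k &
  2 * inner P (F \o J) (h \o J) - inner P (h \o J) (h \o J) <=
  2^-1 * energy F a + (2 * inner P (F \o J) (k \o J) - inner P (k \o J) (k \o J)).
Proof.
move=> mF iF nas ch; have [k ck hk] := averaging ch; exists k => //.
have mh := cylindrical_measurable ch; have mk := cylindrical_measurable ck.
have ih := cylindrical_sqint measurable_J' ch.
have ik := cylindrical_sqint measurable_J' ck.
have iF' := square_integrable_resample a mF iF.
have ih' := square_integrable_resample a mh ih.
have kE : k \o Ja a = k \o J by apply/funext => w; exact: cylindrical_resample ck.
have Fh' := hk F mF iF.
have hh' : inner P (h \o J) (h \o Ja a) = inner P (k \o J) (k \o J).
  rewrite hk// (inner_resample a mh mk ih ik) kE innerC; exact: hk.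
have F'h := inner_exchange a mF mh iF ih.
have F'h' := inner_resample a mF mh iF ih.
have h'h' := inner_resample a mh mh ih ih.
pose f := (F \o J) \- (F \o Ja a); pose g := (h \o J) \- (h \o Ja a).
have if_ : square_integrable P f by exact: square_integrableB.
have ig : square_integrable P g by exact: square_integrableB.
have := inner_ge0 P (f \- g); rewrite (innerBB if_ ig).
have -> : inner P f f = energy F a by [].
have -> : inner P f g = 2 * inner P (F \o J) (h \o J) - 2 * inner P (F \o J) (k \o J).
  by rewrite innerBl// !innerBr// -F'h' -F'h Fh'; ring.
have -> : inner P g g = 2 * inner P (h \o J) (h \o J) - 2 * inner P (k \o J) (k \o J).
  by rewrite (innerBB ih ih') -h'h' hh'; ring.
lra.
Qed.

Let efron_stein_cylindrical (F : M -> R) s h : measurable_fun setT F ->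
  square_integrable P (F \o J) ->
  (forall (g : T -> R) K, measurable_fun setT (g : TZ -> R) -> (forall w, `|g w| <= K) ->
    inner P (F \o J) g = 0) ->
  uniq s -> cylindrical s h ->
  2 * inner P (F \o J) (h \o J) - inner P (h \o J) (h \o J) <=
  2^-1 * \sum_(a <- s) energy F a.
Proof.
move=> mF iF F0; elim: s h => [|a s IH] h /=.
  move=> _ /cylindrical_nil[g [mg [K gK] hE]].
  have -> : h \o J = g by apply/funext => w /=; rewrite hE.
  rewrite (F0 g K)// big_nil !mulr0 sub0r oppr_le0; exact: inner_ge0.
move=> /andP[nas us] ch.
have [k ck] := efron_stein_step mF iF nas ch.
move=> /le_trans; apply; rewrite big_cons mulrDr lerD2l; exact: IH.
Qed.

(** 2 <f, h> - <h, h> = <f, f> - <f - h, f - h>, and h can be chosen close to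
    f in L2. *)
Let efron_stein_approx (F : M -> R) (e : R) : measurable_fun setT F ->
  square_integrable P (F \o J) ->
  (forall (g : T -> R) K, measurable_fun setT (g : TZ -> R) -> (forall w, `|g w| <= K) ->
    inner P (F \o J) g = 0) -> 0 < e ->
  exists2 s : seq A, uniq s &
    inner P (F \o J) (F \o J) <= 2^-1 * \sum_(a <- s) energy F a + e.
Proof.
move=> mF iF F0 e0.
pose J' : {RV P >-> M} := HB.pack J (isMeasurableFun.Build _ _ _ _ _ measurable_J').
pose V h := exists2 s, uniq s & cylindrical s h.
have VD h k : V h -> V k -> V (h \+ k).
  move=> [s us ch] [t ut ck]; exists (undup (s ++ t)); first exact: undup_uniq.
  by apply: cylindrical_add; [apply: cylindrical_sub ch|apply: cylindrical_sub ck];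
    move=> a ast; rewrite mem_undup mem_cat ast ?orbT.
have VZ c h : V h -> V (fun m => c * h m).
  by move=> [s us ch]; exists s => //; exact: cylindrical_scale.
have Vboxes C : boxes C -> V (\1_C).
  move=> [_ [B [mB [s sB]] <-] [S mS <-]]; exists (undup s); first exact: undup_uniq.
  rewrite (_ : \1_ _ = fun m => \1_S m.2 * \1_(box B) m.1 + 0); last first.
    by apply/funext => m; rewrite addr0 !indicE in_setX/= -natrM mulnb andbC.
  apply: (@cylindricalD _ (\1_S) 1) => //.
  - by move=> w; rewrite indicE; case: (_ \in _); rewrite ?normr1 ?normr0.
  - by move=> a; rewrite mem_undup; exact: sB.
  - exact: cylindrical0.
have Vm h : V h -> measurable_fun setT h by move=> [s _ /cylindrical_measurable].
have iF2 : (distribution P J').-integrable setT (fun m => (F m ^+ 2)%:E).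
  apply: integrable_pushforward => //; last exact: iF.2.
  by apply/measurable_EFinP; exact: measurable_funX.
have [h [s us ch]] := L2_approximation boxesT boxes_setI boxesE Vm VD VZ Vboxes mF iF2 e0.
have mh := cylindrical_measurable ch.
have ih := cylindrical_sqint measurable_J' ch.
rewrite ge0_integral_distribution//; last 2 first.
- by apply/measurable_EFinP; apply: measurable_funX; exact: measurable_funB.
- by move=> m; rewrite lee_fin sqr_ge0.
have iFh : square_integrable P ((F \o J) \- (h \o J)) by exact: square_integrableB.
rewrite -[X in (X <= _)%E -> _](inner_EFin iFh) lee_fin => Fhe.
exists s => //; have := efron_stein_cylindrical mF iF F0 us ch.
by move: Fhe; rewrite innerBB//; lra.
Qed.

(** * The conditional inequality *)

Local Open Scope ereal_scope.

Let increment (F : prod_space E -> R) a w : R := (F (joint X w) - F (resample X X' a w))%R.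

Let measurable_joint : measurable_fun setT (joint X).
Proof. exact: (measurableT_comp measurable_fst measurable_J'). Qed.

Let measurable_resample a : measurable_fun setT (resample X X' a).
Proof. exact: (measurableT_comp measurable_fst (measurable_Ja a)). Qed.

Let measurable_increment F a : measurable_fun setT F -> measurable_fun setT (increment F a).
Proof.
by move=> mF; apply: measurable_funB; exact: measurableT_comp.
Qed.

Let integral_sqr_restrict (u : T -> R) S : <<s GZ >> S ->
  \int[P]_(w in S) (u w ^+ 2)%:E = \int[P]_w ((ind S w * u w) ^+ 2)%:E.
Proof.
move=> GS; rewrite integral_mkcond; apply: eq_integral => w _.
rewrite epatch_indic/= -EFinM; congr EFin.
by rewrite indicE; case: (_ \in _); rewrite ?mul1r ?mulr1// mul0r mulr0 expr0n.
Qed.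

(** [efron_stein_approx] for the product of F and the indicator of S; the
    indicator depends on Z only, so resampling does not affect it. *)
Let efron_stein_on (F : prod_space E -> R) (S : set T) (e : R) :
  measurable_fun setT F -> square_integrable P (F \o joint X) ->
  (forall S', <<s GZ >> S' -> \int[P]_(w in S') (F (joint X w))%:E = 0) ->
  <<s GZ >> S -> (0 < e)%R ->
  exists2 s : seq A, uniq s &
    \int[P]_(w in S) (F (joint X w) ^+ 2)%:E <=
    2^-1%:E * (\sum_(a <- s) \int[P]_(w in S) (increment F a w ^+ 2)%:E) + e%:E.
Proof.
move=> mF iF F0 GS e0.
have mS := sub_measurable GZ_measurable GS.
have mindS : measurable_fun setT (\1_S : TZ -> R) by exact: (@measurable_indic _ TZ).
have ind1 w : (`|ind S w| <= 1)%R.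
  by rewrite indicE; case: (_ \in _); rewrite ?normr1 ?normr0.
pose FS (m : M) : R := (\1_S m.2 * F m.1)%R.
have mFS : measurable_fun setT FS.
  apply: measurable_funM; first exact: (measurableT_comp mindS measurable_snd).
  exact: (measurableT_comp mF measurable_fst).
have iFS : square_integrable P (FS \o J).
  rewrite (_ : FS \o J = ((F \o joint X) \* ind S)%R); last first.
    by apply/funext => w; rewrite /= /FS/= mulrC.
  by apply: (square_integrableM iF _ ind1); exact: measurable_indic.
have FS0 (g : T -> R) K : measurable_fun setT (g : TZ -> R) ->
    (forall w, `|g w| <= K)%R -> inner P (FS \o J) g = 0%R.
  move=> mg gK; have mg' := sub_measurable_fun GZ_measurable mg.
  have iF1 := integrable_square iF.
  rewrite (_ : inner P (FS \o J) g =
      fine (\int[P]_w ((ind S w * g w) * F (joint X w))%:E)); last first.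
    by congr fine; apply: eq_integral => w _; congr EFin; rewrite /= /FS/= mulrAC.
  have -> // := integral_pullout GZ_measurable (f := F \o joint X) (v := (ind S \* g)%R) => //.
    exact: measurable_funM.
  apply: integrable_mul_square => //; apply: (@square_integrable_bounded _ _ _ _ _ K).
    by apply: measurable_funM => //; exact: measurable_indic.
  by move=> w; rewrite normrM -[leRHS]mul1r ler_pM.
have [s us sE] := efron_stein_approx mFS iFS FS0 e0; exists s => //.
rewrite (integral_sqr_restrict _ GS).
rewrite [X in _ <= _ * X + _](_ : _ = (\sum_(a <- s) energy FS a)%R%:E); last first.
  rewrite -sumEFin; apply: eq_bigr => a _; rewrite (integral_sqr_restrict _ GS).
  rewrite inner_EFin; last first.
    by apply: square_integrableB => //; exact: square_integrable_resample.
  by apply: eq_integral => w _; rewrite /= /FS /increment/= mulrBr.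
rewrite -[X in X <= _](inner_EFin iFS) -EFinM -EFinD lee_fin.
exact: sE.
Qed.

Let integrand F a w : \bar R := (increment F a w ^+ 2)%:E.
Let local_energy F a := condexp P GXZ (integrand F a).

(** The local energies are almost surely nonnegative, simultaneously for the
    countably many coordinates, so the series of negative parts vanishes. *)
Let carre_du_champ_ae (F : prod_space E -> R) : measurable_fun setT F ->
  let S w := 2^-1%:E * \esum_(a in [set: A]) maxe (local_energy F a w) 0 in
  [/\ measurable_fun setT (carre_du_champ Z X X' F F), measurable_fun setT S &
      {ae P, forall w, carre_du_champ Z X X' F F w = S w}].
Proof.
move=> mF S.
have mi a : measurable_fun setT (integrand F a).
  by apply/measurable_EFinP; apply: measurable_funX; exact: measurable_increment.
have i0 a w : 0 <= integrand F a w by rewrite lee_fin sqr_ge0.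
have mD a : measurable_fun setT (local_energy F a).
  apply: (sub_measurable_fun (@sigma_fam_measurable setT)).
  by apply: condexp_measurable; apply: condexpP_ge0.
have mpos : measurable_fun setT (fun w => \esum_(a in [set: A]) maxe (local_energy F a w) 0).
  apply: measurable_esum => [a|a w]; last by rewrite le_max lexx orbT.
  by apply: measurable_maxe => //.
have mneg : measurable_fun setT (fun w => \esum_(a in [set: A]) maxe (- local_energy F a w) 0).
  apply: measurable_esum => [a|a w]; last by rewrite le_max lexx orbT.
  by apply: measurable_maxe => //; exact: measurableT_comp.
have carreE : carre_du_champ Z X X' F F = fun w => 2^-1%:E *
    (\esum_(a in [set: A]) maxe (local_energy F a w) 0 -
     \esum_(a in [set: A]) maxe (- local_energy F a w) 0) by [].
split.
- by rewrite carreE; apply: measurable_funeM; exact: emeasurable_funB.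
- by apply: measurable_funeM.
- rewrite carreE.
  have : {ae P, forall w a, 0 <= local_energy F a w}.
    by apply: ae_forall_countable => a; apply: condexp_ae_ge0.
  apply: filterS => w D0; rewrite /S; congr (_ * _).
  rewrite [X in _ - X]esum1 ?sube0// => a _.
  by rewrite max_r// leeNl oppe0.
Qed.

(** Both conditional expectations are tested on the sets S of the sigma-algebra
    of Z, where finite subsums already bound the integral of the series from
    below. *)
Lemma conditional_efron_stein (F : prod_space E -> R) :
  measurable_fun setT F -> P.-integrable setT (EFin \o (fun w => F (joint X w) ^+ 2)%R) ->
  {ae P, forall w, condexp P GZ (fun w' => (F (joint X w'))%:E) w = 0} ->
  {ae P, forall w, condvar P GZ (fun w' => (F (joint X w'))%:E) w <=
    condexp P GZ (carre_du_champ Z X X' F F) w}.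
Proof.
move=> mF iF2 F0.
have iF : square_integrable P (F \o joint X).
  by split => //; exact: measurableT_comp.
have mY : measurable_fun setT (fun w => (F (joint X w))%:E).
  by apply/measurable_EFinP; exact: measurableT_comp.
have iY : P.-integrable setT (fun w => (F (joint X w))%:E).
  exact: integrable_square iF.
have cY := condexpP GZ_measurable iY.
have mcY := sub_measurable_fun GZ_measurable (condexp_measurable cY).
have F0S S : <<s GZ >> S -> \int[P]_(w in S) (F (joint X w))%:E = 0.
  move=> GS; have mS := sub_measurable GZ_measurable GS.
  rewrite -cY.2// (@ae_eq_integral _ _ _ P S (cst 0))//; first exact: integral0.
    exact: measurable_funTS.
  by apply: filterS F0 => w + _.
pose Y2 w : \bar R := (F (joint X w) ^+ 2)%:E.
have Y2_ge0 w : 0 <= Y2 w by rewrite lee_fin sqr_ge0.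
have mY2 : measurable_fun setT Y2.
  by apply/measurable_EFinP; apply: measurable_funX; exact: measurableT_comp.
have -> : condvar P GZ (fun w => (F (joint X w))%:E) = condexp P GZ Y2.
  apply: condexp_ae_eq => //.
    under eq_fun do rewrite expe2.
    by apply: emeasurable_funM; exact: emeasurable_funB.
  by apply: filterS F0 => w ->; rewrite sube0.
have [mcarre mcarre' carreE] := carre_du_champ_ae mF.
set carre' := (X in measurable_fun _ X) in mcarre'.
have carre'_ge0 w : 0 <= carre' w.
  by apply: mule_ge0 => //; apply: esum_ge0 => a _; rewrite le_max lexx orbT.
rewrite (condexp_ae_eq GZ_measurable mcarre mcarre' carreE).
have cY2 := condexpP_ge0 P GZ_measurable mY2 Y2_ge0.
have cG := condexpP_ge0 P GZ_measurable mcarre' carre'_ge0.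
apply: (ae_le_of_integrals GZ_measurable).
- exact: condexp_measurable cY2.
- exact: condexp_measurable cG.
- by apply: condexp_integrable => //; exact: iF.2.
move=> S GS; have mS := sub_measurable GZ_measurable GS.
rewrite cY2.2// cG.2//; apply/lee_addgt0Pr => e e0.
have [s us sE] := efron_stein_on mF iF F0S GS e0.
apply: (le_trans sE); rewrite leeD2r//.
have mi a : measurable_fun setT (integrand F a).
  by apply/measurable_EFinP; apply: measurable_funX; exact: measurable_increment.
have i0 a w : 0 <= integrand F a w by rewrite lee_fin sqr_ge0.
have GXZ_measurable := @sigma_fam_measurable setT.
have cD a := condexpP_ge0 P GXZ_measurable (mi a) (i0 a).
have mD a := sub_measurable_fun GXZ_measurable (condexp_measurable (cD a)).
have mp a : measurable_fun setT (fun w => maxe (local_energy F a w) 0).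
  by apply: measurable_maxe => //; exact: mD.
have msum : measurable_fun S (fun w => \sum_(a <- s) maxe (local_energy F a w) 0).
  by apply: emeasurable_sum => a; exact: measurable_funTS.
have p0 a w : 0 <= maxe (local_energy F a w) 0 by rewrite le_max lexx orbT.
have -> : \sum_(a <- s) \int[P]_(w in S) (increment F a w ^+ 2)%:E =
    \int[P]_(w in S) \sum_(a <- s) maxe (local_energy F a w) 0.
  rewrite ge0_integral_sum//; last by move=> a; exact: measurable_funTS.
  apply: eq_bigr => a _; rewrite -(cD a).2; last exact: GZ_sub.
  apply: ae_eq_integral => //; [exact: measurable_funTS (mD a)|exact: measurable_funTS|].
  have := condexp_ae_ge0 P GXZ_measurable (mi a) (i0 a).
  by apply: filterS => w D0 _; rewrite max_l.
rewrite -ge0_integralZl//; last by move=> w _; exact: sume_ge0.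
apply: ge0_le_integral => //.
- by move=> w _; rewrite mule_ge0// sume_ge0.
- exact: measurable_funeM.
- exact: measurable_funTS.
- by move=> w _; rewrite lee_wpmul2l//; exact: esum_ge_uniq.
Qed.

End conditionally_independent_family.

Theorem theorem3p4 (R : realType) (d : measure_display) (T : measurableType d)
    (P : probability T R)
    (A : countType) (E0 : ptopologicalType) (E : A -> ptopologicalType)
    (polishE0 : polish R E0) (polishE : forall a : A, polish R (E a))
    (Z : {RV P >-> borel E0}) (X X' : forall a : A, {RV P >-> borel (E a)})
    (indepX : cond_independent Z X) (copyX' : cond_independent_copy Z X X')
    (F : {mfun prod_space E >-> R})
    (F2 : (fun w : T => F (joint X w)) \in Lfun P 2%:E)
    (F0 : {ae P, forall w : T,
             condexp P (sigma_of Z) (fun w' : T => (F (joint X w'))%:E) w = 0%E}) :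
  {ae P, forall w : T,
    (condvar P (sigma_of Z) (fun w' : T => (F (joint X w'))%:E) w
     <= condexp P (sigma_of Z) (carre_du_champ Z X X' F F) w)%E}.
Proof.
have mF : measurable_fun setT F by [].
exact: conditional_efron_stein mF (Lfun2_integrable_sqr F2) F0.
Qed.
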